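(* Let $\Lambda\subset\mathbb{R}^N$ be a self-similar arc of Hausdorff dimension $s>1$. Then $\Lambda$ is a strict Whitney set with criticality $\operatorname{Cr}(\Lambda)=s$.
   Context: A contractive similitude with ratio $r\in(0,1)$ is a map $S:\mathbb{R}^N\to\mathbb{R}^N$ with $|S(x)-S(y)|=r|x-y|$ for all $x,y$. Given contractive similitudes $S_1,\dots,S_\ell$, the associated self-similar set is the unique nonempty compact set $\Lambda$ with $\Lambda=\bigcup_{i=1}^{\ell}S_i(\Lambda)$. It is called a self-similar arc if $\Lambda$ is an arc (a homeomorphic image of $[0,1]$) and (1) $S_i(\Lambda)\cap S_j(\Lambda)$ is a singleton whenever $|i-j|=1$; (2) $S_i(\Lambda)\cap S_j(\Lambda)=\emptyset$ whenever $|i-j|>1$. A connected set $E\subset\mathbb{R}^N$ is a strict Whitney set if there is a $C^1$ function $f:\mathbb{R}^N\to\mathbb{R}$ with $\nabla f|_E\equiv 0$ such that $f|_E$ is not constant and $f$ is non-constant on each non-empty relatively open subset of $E$. The criticality of $E$ is $\operatorname{Cr}(E)=\sup\{r:$ there exist a non-constant function $f:E\to\mathbb{R}$ and $M>0$ such that $|f(x)-f(y)|\le M|x-y|^r$ for all $x,y\in E\}$. *)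

(* Defs.v *)
From mathcomp Require Import all_boot all_order all_algebra.
From mathcomp Require Import all_classical all_reals all_analysis.

Set Implicit Arguments.
Unset Strict Implicit.
Unset Printing Implicit Defensive.
Import Order.TTheory GRing.Theory Num.Theory.
Import numFieldNormedType.Exports.

Local Open Scope classical_set_scope.
Local Open Scope ring_scope.

(* The library norm on ['rV[R]_N] is the sup norm.  It induces the usual
   topology, so the topological notions below are the library ones, but the
   metric notions are stated with the Euclidean norm. *)
Definition enorm (R : realType) (N : nat) (x : 'rV[R]_N) : R :=
  Num.sqrt (\sum_(i < N) x 0 i ^+ 2).

Definition contractive_similitude (R : realType) (N : nat)
    (S : 'rV[R]_N -> 'rV[R]_N) : Prop :=
  exists r : R, 0 < r < 1 /\
    forall x y, enorm (S x - S y) = r * enorm (x - y).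

(* For contractive similitudes there is exactly one such L (Hutchinson). *)
Definition self_similar_set (R : realType) (N l : nat)
    (S : 'I_l -> 'rV[R]_N -> 'rV[R]_N) (L : set 'rV[R]_N) : Prop :=
  [/\ L !=set0, compact L & L = \bigcup_(i : 'I_l) (S i @` L)].

Definition homeomorphic (T U : topologicalType) (A : set T) (B : set U) : Prop :=
  exists (f : T -> U) (g : U -> T),
    [/\ {within A, continuous f}, {within B, continuous g},
        f @` A `<=` B, g @` B `<=` A &
        (forall x, A x -> g (f x) = x) /\ (forall y, B y -> f (g y) = y)].

Definition is_arc (R : realType) (N : nat) (L : set 'rV[R]_N) : Prop :=
  homeomorphic (`[0, 1]%classic : set R) L.

Definition self_similar_arc (R : realType) (N : nat) (L : set 'rV[R]_N) : Prop :=
  exists (l : nat) (S : 'I_l -> 'rV[R]_N -> 'rV[R]_N),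
    [/\ forall i, contractive_similitude (S i),
        self_similar_set S L,
        is_arc L,
        forall i j : 'I_l, `|i - j|%N = 1%N ->
          exists p, S i @` L `&` S j @` L = [set p] &
        forall i j : 'I_l, (1 < `|i - j|)%N ->
          S i @` L `&` S j @` L = set0].

Definition ediam (R : realType) (N : nat) (U : set 'rV[R]_N) : \bar R :=
  ereal_sup (0%E |` [set (enorm (p.1 - p.2))%:E | p in U `*` U]).

(* The test for emptiness only matters when t = 0, where the empty set must
   contribute 0 while a singleton contributes 0 `^ 0 = 1. *)
Definition hgauge (R : realType) (N : nat) (t : R) (U : set 'rV[R]_N) : \bar R :=
  if U == set0 then 0%E else (ediam U `^ t)%E.

Definition hausdorff_premeasure (R : realType) (N : nat) (t delta : R)
    (E : set 'rV[R]_N) : \bar R :=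
  ereal_inf [set (\sum_(0 <= k <oo) hgauge t (U k))%E |
    U in [set U : nat -> set 'rV[R]_N |
      E `<=` \bigcup_k U k /\ forall k, (ediam (U k) <= delta%:E)%E]].

Definition hausdorff_measure (R : realType) (N : nat) (t : R)
    (E : set 'rV[R]_N) : \bar R :=
  ereal_sup [set hausdorff_premeasure t delta E | delta in [set d : R | 0 < d]].

Definition hausdorff_dim (R : realType) (N : nat) (E : set 'rV[R]_N) : \bar R :=
  ereal_inf [set t%:E | t in [set t : R | 0 <= t /\ hausdorff_measure t E = 0%E]].

Definition gradient (R : realType) (N : nat) (f : 'rV[R]_N -> R)
    (x : 'rV[R]_N) : 'rV[R]_N :=
  \row_(i < N) 'D_(delta_mx 0 i) f x.

Definition C1 (R : realType) (N : nat) (f : 'rV[R]_N -> R) : Prop :=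
  (forall x, differentiable f x) /\ continuous (gradient f).

Definition nonconstant_on (T U : Type) (A : set T) (f : T -> U) : Prop :=
  exists x y, [/\ A x, A y & f x <> f y].

(* The relatively open subsets of E are the sets E `&` U with U open. *)
Definition strict_whitney_set (R : realType) (N : nat) (E : set 'rV[R]_N) : Prop :=
  connected E /\
  exists f : 'rV[R]_N -> R,
    [/\ C1 f,
        forall x, E x -> gradient f x = 0,
        nonconstant_on E f &
        forall U : set 'rV[R]_N, open U -> E `&` U !=set0 ->
          nonconstant_on (E `&` U) f].

(* A function on E is represented by a total function of which only the values
   on E are used. *)
Definition criticality (R : realType) (N : nat) (E : set 'rV[R]_N) : \bar R :=
  ereal_sup [set r%:E | r in [set r : R |
    exists (f : 'rV[R]_N -> R) (M : R),
      [/\ nonconstant_on E f, 0 < M &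
          forall x y, E x -> E y -> `|f x - f y| <= M * enorm (x - y) `^ r]]].

(* Main.v *)
(** Write [L = gam @` `[0, 1]] and let [r_i] be the ratios of the maps.  Covering
    [L] by its level [n] pieces shows that [\sum_i r_i `^ t < 1] forces the
    [t]-dimensional measure to vanish, so [\sum_i r_i `^ t > 1] for every [t < s];
    no separation beyond that of the arc is needed, and no lower bound on the
    dimension of [L] is ever proved.

    Hoelder functions.  Two points of [L] on either side of a junction may be much
    closer than their distance to the junction, so the natural self-similar
    measure of subarcs need not be Hoelder.  Instead, pick a fixed word [m] whose
    piece avoids the end points of [L] and use the maps [T_w \o T_m], [w] of length
    [n]: their images are pairwise disjoint, and for [n] large the sum of
    [ratio `^ t] exceeds 1.  The cumulative mass along the arc of the resulting
    Cantor measure is [t]-Hoelder: at the first level that separates two nearby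
    points, the subarc between them carries no mass.  A weighted sum of such
    functions, transported to all small pieces of [L], is [t]-Hoelder and strictly
    increasing along the arc.  With [1 < t < s], Whitney's extension theorem (with
    zero gradient data) makes it a [C1] function critical on [L].

    Conversely, a [t]-Hoelder function with [t > s] maps the connected set [L] onto
    a Lebesgue null interval. *)
From HB Require Import structures.
Require Import Defs.
From mathcomp Require Import all_boot all_order all_algebra.
From mathcomp Require Import all_classical all_reals all_analysis.
From mathcomp Require Import ring lra.

Set Implicit Arguments.
Unset Strict Implicit.
Unset Printing Implicit Defensive.
Import Order.TTheory GRing.Theory Num.Theory.
Import numFieldNormedType.Exports.

Local Open Scope classical_set_scope.
Local Open Scope ring_scope.

(** An explicit first-order estimate is the little-o condition in expanded form, and uniqueness of
    the differential then identifies it as [dL]. *)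
Lemma differentiable_eps (R : realType) (V W : normedModType R) (f : V -> W)
    (dL : {linear V -> W}) x : continuous dL ->
  (forall e, 0 < e -> exists2 d, 0 < d & forall v, `|v| < d ->
    `|f (x + v) - f x - dL v| <= e * `|v|) ->
  differentiable f x /\ 'd f x = dL :> (V -> W).
Proof.
move=> cdL H; have E : f \o shift x = cst (f x) + dL +o_ 0 id.
  apply/eqaddoP => e /H[d d0 dP]; apply/nbhs_normP; exists d => // v.
  rewrite /= sub0r normrN => /dP; rewrite !fctE /= [v + x]addrC.
  by rewrite opprD addrA.
have U := diff_unique cdL E; split => //.
by apply/diff_locallyP; rewrite U; split.
Qed.

(** * Functions with continuous partial derivatives *)

Section C1_calculus.
Variables (R : realType) (N : nat).
Implicit Types (f g : 'rV[R]_N -> R) (x v : 'rV[R]_N).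

Lemma coord_le_norm v i : `|v 0 i| <= `|v|.
Proof.
rewrite [leRHS]/Num.norm /= mx_normrE.
exact: (@le_bigmax _ _ _ _ (fun ij => `|v ij.1 ij.2|) (0, i)).
Qed.

Lemma norm_le_coord v (r : R) : 0 <= r -> (forall i, `|v 0 i| <= r) -> `|v| <= r.
Proof.
move=> r0 vr; rewrite [leLHS]/Num.norm /= mx_normrE.
by apply/bigmax_leP; split => // -[j i] _ /=; rewrite ord1.
Qed.

Definition dotp (a : 'I_N -> R) v : R := \sum_(i < N) v 0 i * a i.

Lemma dotp_linear a : linear (dotp a).
Proof.
move=> k u v; rewrite /dotp scaler_sumr -big_split /=; apply: eq_bigr => i _.
by rewrite !mxE mulrDl -scalerAl.
Qed.

Lemma dotp_continuous a : continuous (dotp a).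
Proof.
rewrite /dotp; apply: continuous_big => [|i _ x]; first exact: add_continuous.
by apply: (@cvgMr_tmp _ _ _ (nbhs_filter x)); exact: coord_continuous.
Qed.

Definition C1_with f (G : 'I_N -> 'rV[R]_N -> R) : Prop :=
  [/\ forall x, differentiable f x,
      forall x i, 'D_(delta_mx 0 i) f x = G i x &
      forall i, continuous (G i)].

Lemma diff_dotp f x : differentiable f x ->
  forall v, 'd f x v = dotp (fun i => 'D_(delta_mx 0 i) f x) v.
Proof.
move=> df v; rewrite {1}(row_sum_delta v) linear_sum; apply: eq_bigr => i _.
by rewrite linearZ/= deriveE.
Qed.

Lemma differentiable_dotpP f x a :
  (differentiable f x /\ forall i, 'D_(delta_mx 0 i) f x = a i) <->
  forall e, 0 < e -> exists2 d, 0 < d & forall v, `|v| < d ->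
    `|f (x + v) - f x - dotp a v| <= e * `|v|.
Proof.
split=> [[df da] e e0|H].
  have /diff_locallyP[_ /eqaddoP/(_ e e0)] := df.
  move=> /nbhs_normP[d /= d0 dP]; exists d => // v vd.
  have := dP v; rewrite /= sub0r normrN => /(_ vd).
  rewrite !fctE /= addrC.
  congr (_ <= _); congr (`| _ |).
  rewrite addrC [v + x]addrC opprD addrA diff_dotp//; congr (_ - _).
  by apply: eq_bigr => i _; rewrite da.
pose dM := GRing.isLinear.Build _ _ _ _ (dotp a) (@dotp_linear a).
pose dL : {linear _ -> _} := HB.pack (dotp a) dM.
have [df ddL] := differentiable_eps (@dotp_continuous a : continuous dL) H.
split => // i; rewrite deriveE// ddL /= /dotp (bigD1 i)//= big1.
  by rewrite mxE !eqxx mul1r addr0.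
by move=> j ji; rewrite mxE eqxx /= (negbTE ji) mul0r.
Qed.

Lemma C1_withE f G : C1_with f G -> C1 f.
Proof.
move=> [df dG cG]; split => // x.
apply/(@cvgrPdist_le _ _ _ _ (nbhs_filter x)) => e e0.
suff: \forall y \near x, forall i, `|G i x - G i y| <= e.
  apply: filterS => y xy; apply: norm_le_coord; first exact: ltW.
  by move=> i; rewrite !mxE !dG.
apply: (@filter_forall _ _ _ _ (nbhs_filter x)) => i.
by have /(@cvgrPdist_le _ _ _ _ (nbhs_filter x)) := cG i x; exact.
Qed.

Lemma C1_with_gradient f G x i : C1_with f G -> gradient f x 0 i = G i x.
Proof. by move=> [_ dG _]; rewrite mxE dG. Qed.

Lemma C1_with_ext f g G H : C1_with f G -> f =1 g -> (forall i, G i =1 H i) ->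
  C1_with g H.
Proof.
move=> fG /funext <- GH; have -> // : H = G.
by apply/funext => i; apply/funext => x; rewrite GH.
Qed.

Lemma C1_cst (c : R) : C1_with (fun=> c) (fun _ _ => 0).
Proof.
by split => [x|x i|i]; [exact: differentiable_cst|exact: derive_cst|];
  move=> y; exact: (@cvg_cst _ _ _ _ (nbhs_filter y)).
Qed.

Lemma C1D f g G H : C1_with f G -> C1_with g H ->
  C1_with (fun x => f x + g x) (fun i x => G i x + H i x).
Proof.
move=> [df dG cG] [dg dH cH]; split => [x|x i|i x].
- exact: differentiableD.
- by rewrite -dG -dH; apply: deriveD; exact: diff_derivable.
- by apply: (@cvgD _ _ _ _ (nbhs_filter x)); [exact: cG|exact: cH].
Qed.

Lemma C1M f g G H : C1_with f G -> C1_with g H ->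
  C1_with (fun x => f x * g x) (fun i x => G i x * g x + f x * H i x).
Proof.
move=> [df dG cG] [dg dH cH]; split => [x|x i|i x].
- exact: differentiableM.
- rewrite -dG -dH deriveM; try exact: diff_derivable.
  by rewrite addrC; congr (_ + _); rewrite mulrC.
- have FF := nbhs_filter x.
  apply: (@cvgD _ _ _ _ FF); apply: (@cvgM _ _ _ FF);
    by [exact: cG|exact: cH|exact: differentiable_continuous].
Qed.

Lemma C1Z f G (c : R) : C1_with f G ->
  C1_with (fun x => c * f x) (fun i x => c * G i x).
Proof.
move=> fG; apply: C1_with_ext (C1M (C1_cst c) fG) _ _ => // i x /=.
by rewrite mul0r add0r.
Qed.

Lemma C1B f g G H : C1_with f G -> C1_with g H ->
  C1_with (fun x => f x - g x) (fun i x => G i x - H i x).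
Proof.
move=> fG gH; apply: C1_with_ext (C1D fG (C1Z (-1) gH)) _ _ => [x|i x] /=;
by rewrite mulN1r.
Qed.

Lemma C1_sum (I : Type) (r : seq I) (f_ : I -> 'rV[R]_N -> R) G_ :
  (forall k, C1_with (f_ k) (G_ k)) ->
  C1_with (fun x => \sum_(k <- r) f_ k x) (fun i x => \sum_(k <- r) G_ k i x).
Proof.
move=> fG; elim: r => [|k r IH].
  by apply: C1_with_ext (C1_cst 0) _ _ => [x|i x]; rewrite big_nil.
by apply: C1_with_ext (C1D (fG k) IH) _ _ => [x|i x]; rewrite big_cons.
Qed.

Lemma C1_coord (phi dphi : R -> R) j :
  (forall t, is_derive t (1 : R) phi (dphi t)) -> continuous dphi ->
  C1_with (fun x => phi (x 0 j)) (fun i x => (i == j)%:R * dphi (x 0 j)).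
Proof.
move=> dp cdp.
pose c := fun x : 'rV[R]_N => x 0 j.
have dc x : differentiable c x by exact: differentiable_coord.
have dphi1 t : differentiable phi t by apply/derivable1_diffP; exact: ex_derive.
have d x : differentiable (phi \o c) x by exact: differentiable_comp.
have Dc x i : 'D_(delta_mx 0 i) c x = (i == j)%:R.
  apply: cvg_lim => //.
  have cE : \forall h \near 0^', h^-1 *: ((c \o shift x) (h *: delta_mx 0 i) - c x) =
      (i == j)%:R.
    have := @nbhs_dnbhs_neq R 0; apply: filterS => h h0 /=.
    rewrite /c !mxE eqxx /= addrK eq_sym /GRing.scale /=.
    by case: eqP => _; rewrite ?mulr0// mulr1 mulVf.
  apply: cvg_trans (@cvg_cst _ ((i == j)%:R : R) _ (0^') _).
  by apply: near_eq_cvg; near=> h; apply/esym; near: h.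
split => // [x i|i x].
- transitivity ('d phi (c x) ('d c x 'e_i)).
    by rewrite deriveE// diff_comp.
  by rewrite -(deriveE _ (dc x)) Dc diff1E//= derive1E derive_val.
- apply: (@cvgMl_tmp _ _ _ (nbhs_filter x)).
  exact: (@continuous_comp _ _ _ c dphi x (@coord_continuous _ _ _ 0 j x) (cdp _)).
Unshelve. all: by end_near. Qed.

(** As [r] has no repetition, each coordinate enters at most one factor and the product rule leaves
    a single term. The indicator makes the formula valid for the partial products met in the
    induction. *)
Lemma C1_prod_coord (r : seq 'I_N) (phi dphi : 'I_N -> R -> R) :
  uniq r ->
  (forall j t, is_derive t (1 : R) (phi j) (dphi j t)) -> (forall j, continuous (dphi j)) ->
  C1_with (fun x => \prod_(j <- r) phi j (x 0 j))
    (fun i x => (i \in r)%:R *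
       \prod_(j <- r) (if j == i then dphi j (x 0 j) else phi j (x 0 j))).
Proof.
move=> + dp cdp; elim: r => [_|k r IH /= /andP[kr ur]].
  apply: C1_with_ext (C1_cst 1) _ _ => [x|i x]; rewrite ?big_nil//.
  by rewrite in_nil mul0r.
apply: C1_with_ext (C1M (C1_coord k (dp k) (cdp k)) (IH ur)) _ _ => [x|i x].
  by rewrite big_cons.
rewrite big_cons inE; have [->|ik] := eqVneq i k; last first.
  by rewrite /= mulr0n !mul0r add0r mulrCA.
rewrite (negbTE kr) /= mulr0n mulr1n !mul1r mul0r mulr0 addr0; congr (_ * _).
rewrite !big_seq; apply: eq_bigr => j jr.
by case: eqP => // jk; rewrite -jk jr in kr.
Qed.

(** The one-variable mean value theorem along the segment from [x] to [x + v]. The factor [N] comes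
    from adding [N] coordinates, each bounded by the sup norm. *)
Lemma C1_mvt f G (c : R) : C1_with f G -> (forall i x, `|G i x| <= c) ->
  forall x v, `|f (x + v) - f x| <= N%:R * c * `|v|.
Proof.
move=> [df dG cG] Gc x v.
pose p := fun t : R => f (x + t *: v).
have dp t : is_derive t (1 : R) p (dotp (G ^~ (x + t *: v)) v).
  pose l := fun t : R => x + t *: v.
  have dl : is_derive t (1 : R) l v.
    have lv : (fun h => h^-1 *: ((l \o shift t) (h *: (1 : R)) - l t)) @ 0^' --> v.
      apply: cvg_trans (@cvg_cst _ v _ (0^') _).
      apply: near_eq_cvg; have := @nbhs_dnbhs_neq R 0; apply: filterS => h h0 /=.
      rewrite /l [h *: 1]mulr1 scalerDl addrA [x + h *: v]addrC -addrA addrK.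
      by rewrite scalerA mulVf// scale1r.
    by apply: DeriveDef; [apply/cvg_ex; exists v|exact: cvg_lim].
  have dl' : differentiable l t by apply/derivable1_diffP; exact: ex_derive.
  have dpl : differentiable (f \o l) t by apply: differentiable_comp.
  apply: DeriveDef; first exact: diff_derivable.
  rewrite deriveE// diff_comp//= -(deriveE (1 : R) dl') derive_val.
  by rewrite diff_dotp//; apply: eq_bigr => i _; rewrite dG.
have cp : {within `[0, 1], continuous p}.
  apply: continuous_subspaceT => t.
  apply: differentiable_continuous; apply/derivable1_diffP.
  have := dp t; by case.
have [t _] := MVT_segment ler01 (fun t _ => dp t) cp.
rewrite /p scale1r scale0r addr0 subr0 mulr1 => ->.
rewrite /dotp; apply: le_trans (ler_norm_sum _ _ _) _.
rewrite (le_trans (ler_sum _ (_ : forall i, true -> _ <= c * `|v|)))//.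
  move=> i _; rewrite normrM mulrC ler_pM//; exact: coord_le_norm.
by rewrite sumr_const card_ord -mulrA mulr_natl.
Qed.

(** Uniform convergence of the gradients controls the increments of [f - f_ n] through the mean
    value inequality. First-order expansions therefore pass to the limit by a three-term estimate,
    although the functions converge only pointwise. *)
Lemma C1_limit (f_ : nat -> 'rV[R]_N -> R) G_ (f : 'rV[R]_N -> R) G (E : nat -> R) :
  (forall n, C1_with (f_ n) (G_ n)) -> E @ \oo --> 0 ->
  (forall n m i x, (n <= m)%N -> `|G_ m i x - G_ n i x| <= E n) ->
  (forall x, f_ ^~ x @ \oo --> f x) ->
  (forall i x, (fun n => G_ n i x) @ \oo --> G i x) ->
  C1_with f G.
Proof.
move=> fG E0 GE ff GG.
have GGE n i x : `|G i x - G_ n i x| <= E n.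
  have c : `|G_ m i x - G_ n i x| @[m --> \oo] --> `|G i x - G_ n i x|.
    by apply: cvg_norm; apply: cvgB; [exact: GG|exact: cvg_cst].
  rewrite -(cvg_lim _ c)//; apply: limr_le; first by apply/cvg_ex; eexists; exact: c.
  by exists n => // m nm; exact: GE.
(* The mean value inequality for [f_ m - f_ n], with [m] sent to infinity. *)
have fE n x v : `|(f (x + v) - f_ n (x + v)) - (f x - f_ n x)| <= N%:R * E n * `|v|.
  have c : `|(f_ m (x + v) - f_ n (x + v)) - (f_ m x - f_ n x)| @[m --> \oo] -->
     `|(f (x + v) - f_ n (x + v)) - (f x - f_ n x)|.
    by apply: cvg_norm; apply: cvgB; apply: cvgB; try exact: ff; exact: cvg_cst.
  rewrite -(cvg_lim _ c)//; apply: limr_le; first by apply/cvg_ex; eexists; exact: c.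
  exists n => // m nm.
  by apply: (C1_mvt (C1B (fG m) (fG n))) => i y; exact: GE.
have Esmall e : 0 < e -> exists n, N%:R * E n <= e /\ E n <= e.
  move=> e0; have /cvgrPdist_le /(_ (e / N.+1%:R)) := E0.
  rewrite divr_gt0// => /(_ isT) [n _ /(_ n (leqnn n))] /=.
  rewrite sub0r normrN => En; exists n.
  have En' : E n <= e / N.+1%:R by exact: le_trans (ler_norm _) En.
  have : N.+1%:R * E n <= e.
    by rewrite mulrC -ler_pdivlMr.
  rewrite -natr1 mulrDl mul1r => H; split.
    have [E0'|/ltW E0'] := leP 0 (E n); first lra.
    by apply: le_trans (ltW e0); rewrite mulr_ge0_le0.
  by rewrite (le_trans En')// ler_pdivrMr// ler_peMr ?(ltW e0)// ler1n.
have D x : differentiable f x /\ forall i, 'D_(delta_mx 0 i) f x = G i x.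
  apply/differentiable_dotpP => e e0.
  have e3 : 0 < e / 3 by lra.
  have [n [n1 n2]] := Esmall _ e3.
  have [dfn dGn _] := fG n.
  have [d d0 dP] := (proj1 (differentiable_dotpP (f_ n) x (fun i => G_ n i x))
    (conj (dfn x) (dGn x)) _ e3).
  exists d => // v /dP vd.
  have -> : f (x + v) - f x - dotp (G^~ x) v =
    (f (x + v) - f_ n (x + v) - (f x - f_ n x)) +
    (f_ n (x + v) - f_ n x - dotp (fun i => G_ n i x) v) -
    dotp (fun i => G i x - G_ n i x) v.
    have -> : dotp (fun i => G i x - G_ n i x) v =
      dotp (G^~ x) v - dotp (fun i => G_ n i x) v.
      by rewrite /dotp -sumrB; apply: eq_bigr => i _; rewrite mulrBr.
    ring.
  have h1 : `|f (x + v) - f_ n (x + v) - (f x - f_ n x)| <= e / 3 * `|v|.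
    by apply: le_trans (fE n x v) _; rewrite ler_wpM2r.
  have h2 : `|dotp (fun i => G i x - G_ n i x) v| <= e / 3 * `|v|.
    apply: le_trans (_ : N%:R * E n * `|v| <= _); last by rewrite ler_wpM2r.
    apply: le_trans (ler_norm_sum _ _ _) _.
    rewrite (le_trans (ler_sum _ (_ : forall i, true -> _ <= E n * `|v|)))//.
      by move=> i _; rewrite normrM mulrC ler_pM//; exact: coord_le_norm.
    by rewrite sumr_const card_ord -mulrA mulr_natl.
  apply: le_trans (ler_normB _ _) _.
  apply: le_trans (lerD (le_trans (ler_normD _ _) (lerD h1 vd)) h2) _.
  by rewrite -!mulrDl; apply: ler_wpM2r => //; lra.
split=> [x|x i|i x]; [exact: (D x).1|exact: (D x).2|].
apply/(@cvgrPdist_le _ _ _ _ (nbhs_filter x)) => e e0.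
have e3 : 0 < e / 3 by lra.
have [n [_ n2]] := Esmall _ e3.
have [_ _ /(_ i x)/(@cvgrPdist_le _ _ _ _ (nbhs_filter x))/(_ _ e3)] := fG n.
apply: filterS => y xy.
have -> : G i x - G i y = (G i x - G_ n i x) + (G_ n i x - G_ n i y) - (G i y - G_ n i y).
  ring.
apply: le_trans (ler_normB _ _) _.
apply: le_trans (lerD (le_trans (ler_normD _ _) (lerD (GGE n i x) xy)) (GGE n i y)) _.
lra.
Qed.

End C1_calculus.
(** * Smoothing on a grid *)

Section spline.
Variable R : realType.
Implicit Types t z : R.

Definition relu t : R := (t + `|t|) / 2.
(** Half the square of the positive part, an antiderivative of [relu]; the absolute value replaces a
    case distinction at 0. *)
Definition relu_int t : R := (t * t + t * `|t|) / 4.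

(** The remainder of the first-order expansion is at most [h * h] in absolute value, whatever the
    signs of [t] and [h + t]. *)
Lemma is_derive_mul_abs t : is_derive t (1 : R) (fun s : R => s * `|s|) (2 * `|t|).
Proof.
suff H : (fun h => h^-1 *: (((fun s : R => s * `|s|) \o shift t) (h *: (1 : R)) - t * `|t|)) @ 0^'
    --> 2 * `|t|.
  by apply: DeriveDef; [apply/cvg_ex; exists (2 * `|t|)|exact: cvg_lim].
apply/cvgrPdist_le => e e0.
have : \forall h \near (0 : R)^', `|h| <= Num.min e (Num.max `|t| e).
  by apply: dnbhs0_le; rewrite lt_min lt_max e0 orbT.
have := @nbhs_dnbhs_neq R 0.
apply: filterS2 => h h0 /= hb.
have /andP[h1 h2] : (`|h| <= e) && (`|h| <= Num.max `|t| e) by rewrite -le_min.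
rewrite [h *: 1]mulr1 /GRing.scale /=.
have -> : 2 * `|t| - h^-1 * ((h + t) * `|h + t| - t * `|t|) =
   h^-1 * (2 * `|t| * h - ((h + t) * `|h + t| - t * `|t|)).
  by rewrite [RHS]mulrBr [2 * `|t| * h]mulrC mulKf.
rewrite normrM normfV ler_pdivrMl ?normr_gt0//.
apply: le_trans (_ : `|h| * `|h| <= _); last by rewrite ler_wpM2l.
rewrite -normrM.
have [t0|t0] := lerP 0 t; have [s0|s0] := lerP 0 (h + t);
rewrite ?(ger0_norm t0) ?(ger0_norm s0) ?(ltr0_norm t0) ?(ltr0_norm s0);
rewrite [leRHS]ger0_norm ?sqr_ge0// ler_norml; apply/andP; split; nra.
Qed.

Lemma is_derive_relu_int t : is_derive t (1 : R) relu_int (relu t).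
Proof.
have -> : relu_int = (fun s : R => (4^-1 : R) *: ((fun s => s * s) s + (fun s => s * `|s|) s)).
  by apply/funext => s; rewrite /relu_int mulrC.
have D1 := is_deriveM (is_derive_id t (1 : R)) (is_derive_id t (1 : R)).
have D2 := is_derive_mul_abs t.
apply: (@is_derive_eq _ _ _ _ t 1 _ _ (is_deriveZ (4^-1) (is_deriveD D1 D2))).
by rewrite /relu /GRing.scale /=; field.
Qed.

Lemma relu_continuous : continuous relu.
Proof.
move=> t; apply: cvgMr_tmp; apply: cvgD; first exact: cvg_id.
by apply: cvg_norm; exact: cvg_id.
Qed.

(* [dstep] is the hat function on [[0, 2]] and [bump] the quadratic B-spline on
   [[-1, 2]]; as [bump] is a difference of values of [step], its integer
   translates sum to 1 by telescoping. *)
Definition step t : R := relu_int t - 2 * relu_int (t - 1) + relu_int (t - 2).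
Definition dstep t : R := relu t - 2 * relu (t - 1) + relu (t - 2).
Definition bump t : R := step (t + 1) - step t.
Definition dbump t : R := dstep (t + 1) - dstep t.

Lemma step_le0 t : t <= 0 -> step t = 0.
Proof.
move=> t0; rewrite /step /relu_int !ler0_norm; try lra; field.
Qed.

Lemma step_ge2 t : 2 <= t -> step t = 1.
Proof.
move=> t0; rewrite /step /relu_int !ger0_norm; try lra; field.
Qed.

Lemma dstep_le0 t : t <= 0 -> dstep t = 0.
Proof.
move=> t0; rewrite /dstep /relu !ler0_norm; try lra; field.
Qed.

Lemma dstep_ge2 t : 2 <= t -> dstep t = 0.
Proof.
move=> t0; rewrite /dstep /relu !ger0_norm; try lra; field.
Qed.

Lemma dstep_ge0 t : 0 <= dstep t.
Proof.
rewrite /dstep /relu; case: (ger0P t) => a; case: (ger0P (t - 1)) => b;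
case: (ger0P (t - 2)) => c; lra.
Qed.

Lemma bump_ge0 t : 0 <= bump t.
Proof.
rewrite /bump /step /relu_int.
have -> : t + 1 - 1 = t by ring.
have -> : t + 1 - 2 = t - 1 by ring.
case: (ger0P (t + 1)) => d; case: (ger0P t) => a; case: (ger0P (t - 1)) => b;
case: (ger0P (t - 2)) => c; nra.
Qed.

Lemma bump_support t : 2 < `|t| -> bump t = 0 /\ dbump t = 0.
Proof.
rewrite /bump /dbump ltr_normr => /orP[h|h].
  by rewrite !step_ge2 ?dstep_ge2; try lra; split; ring.
by rewrite !step_le0 ?dstep_le0; try lra; split; ring.
Qed.

Lemma sum_telescope (F : R -> R) z (M : nat) :
  \sum_(k < M) (F (z - k%:R + 1) - F (z - k%:R)) = F (z + 1) - F (z + 1 - M%:R).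
Proof.
elim: M => [|M IH]; first by rewrite big_ord0 subr0 subrr.
rewrite big_ord_recr /= IH.
have -> : z - M%:R + 1 = z + 1 - M%:R by ring.
have -> : z - M%:R = z + 1 - M.+1%:R by rewrite -natr1; ring.
by rewrite addrA subrK.
Qed.

Lemma sum_bump z (M : nat) : 1 <= z <= M%:R - 1 -> \sum_(k < M) bump (z - k%:R) = 1.
Proof.
move=> /andP[z1 zM]; rewrite (sum_telescope step) step_ge2 ?step_le0; lra.
Qed.

Lemma sum_dbump z (M : nat) : 1 <= z <= M%:R - 1 -> \sum_(k < M) dbump (z - k%:R) = 0.
Proof.
move=> /andP[z1 zM]; rewrite (sum_telescope dstep) dstep_ge2 ?dstep_le0; lra.
Qed.

(** [dbump] is a difference of two nonnegative hat functions, and the integer translates of one hat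
    sum to at most 1. *)
Lemma sum_norm_dbump z (M : nat) : \sum_(k < M) `|dbump (z - k%:R)| <= 2.
Proof.
have dstep1 u : \sum_(k < M) dstep (u - k%:R) <= 1.
  (* The hat is the difference of two unit translates of the ramp [c], whose values lie between 0
     and 1, so the sum telescopes. *)
  pose c t := relu t - relu (t - 1).
  have c01 t : 0 <= c t <= 1.
    rewrite /c /relu; case: (ger0P t) => a; case: (ger0P (t - 1)) => b;
    apply/andP; split; lra.
  have -> : \sum_(k < M) dstep (u - k%:R) =
      \sum_(k < M) (c (u - 1 - k%:R + 1) - c (u - 1 - k%:R)).
    apply: eq_bigr => k _; rewrite /dstep /c.
    have -> : u - 1 - k%:R + 1 = u - k%:R by ring.
    have -> : u - 1 - k%:R = u - k%:R - 1 by ring.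
    have -> : u - k%:R - 1 - 1 = u - k%:R - 2 by ring.
    ring.
  rewrite (sum_telescope c).
  have /andP[_ h1] := c01 (u - 1 + 1); have /andP[h2 _] := c01 (u - 1 + 1 - M%:R).
  lra.
have h1 := dstep1 (z + 1); have h2 := dstep1 z.
apply: le_trans (_ : \sum_(k < M) (dstep (z + 1 - k%:R) + dstep (z - k%:R)) <= _).
  apply: ler_sum => k _; rewrite /dbump.
  have -> : z + 1 - k%:R = z - k%:R + 1 by ring.
  apply: le_trans (ler_normB _ _) _.
  by rewrite !ger0_norm// dstep_ge0.
rewrite big_split /=; lra.
Qed.

Lemma is_derive_bump (h c t : R) :
  is_derive t (1 : R) (fun s => bump (s / h + c)) (dbump (t / h + c) / h).
Proof.
have D a : is_derive t (1 : R) (fun s => relu_int (s / h + a)) (relu (t / h + a) / h).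
  have Da : is_derive t (1 : R) (fun s => s / h + a) (h^-1).
    have -> : (fun s : R => s / h + a) = (h^-1 *: (id : R -> R)) + cst a.
      by apply/funext => s; rewrite !fctE /GRing.scale /= mulrC.
    apply: is_derive_eq (is_deriveD (is_deriveZ h^-1 (is_derive_id t (1 : R)))
      (is_derive_cst a t (1 : R))) _.
    by rewrite addr0 /GRing.scale /= mulr1.
  have := @is_derive1_comp R (relu_int) (fun s => s / h + a) t (relu (t / h + a)) h^-1
    (is_derive_relu_int _) Da.
  exact.
(* The quadratic spline is the third difference of [relu_int], with coefficients 1, -3, 3, -1. *)
have E s : bump (s / h + c) = relu_int (s / h + (c + 1)) + ((-3) * relu_int (s / h + c)
   + (3 * relu_int (s / h + (c - 1)) + (-1) * relu_int (s / h + (c - 2)))).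
  rewrite /bump /step.
  have -> : s / h + c + 1 - 1 = s / h + c by ring.
  have -> : s / h + c + 1 - 2 = s / h + (c - 1) by ring.
  rewrite -!addrA; ring.
rewrite (_ : (fun s => bump (s / h + c)) = (fun s => relu_int (s / h + (c + 1))) +
  ((-3) *: (fun s => relu_int (s / h + c)) + (3 *: (fun s => relu_int (s / h + (c - 1))) +
  (-1) *: (fun s => relu_int (s / h + (c - 2)))))); last first.
  by apply/funext => s; rewrite E !fctE.
apply: is_derive_eq (is_deriveD (D _) (is_deriveD (is_deriveZ (-3) (D _))
  (is_deriveD (is_deriveZ 3 (D _)) (is_deriveZ (-1) (D _))))) _.
rewrite /GRing.scale /= /dbump /dstep.
have -> : t / h + c + 1 - 1 = t / h + c by ring.
have -> : t / h + c + 1 - 2 = t / h + (c - 1) by ring.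
rewrite -!addrA; ring.
Qed.

Lemma dbump_continuous (h c : R) : continuous (fun t => dbump (t / h + c) / h).
Proof.
have rc a : continuous (fun t : R => relu (t + a)).
  move=> t; apply: (@continuous_comp _ _ _ (fun t => t + a) relu); last exact: relu_continuous.
  by apply: cvgD; [exact: cvg_id|exact: cvg_cst].
have dc : continuous dstep.
  move=> t; apply: cvgD; [apply: cvgB|].
  - exact: relu_continuous.
  - apply: cvgMl_tmp; exact: rc.
  - exact: rc.
have db : continuous dbump.
  move=> t; apply: cvgB; last exact: dc.
  apply: (@continuous_comp _ _ _ (fun t => t + 1) dstep); last exact: dc.
  by apply: cvgD; [exact: cvg_id|exact: cvg_cst].
move=> t; apply: cvgMr_tmp.
apply: (@continuous_comp _ _ _ (fun t => t / h + c) dbump); last exact: db.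
apply: cvgD; last exact: cvg_cst.
by apply: cvgMr_tmp; exact: cvg_id.
Qed.

End spline.

(** * Smoothing of nodal values by tensor products of splines *)

Section grid_operator.
Variables (R : realType) (N : nat).
Implicit Types (x v : 'rV[R]_N) (a : 'rV[R]_N -> R) (h : R) (m : nat).

(* The nodes are the points of [h Z^N] with coordinates in [[- m h, m h]]. *)
Let idx m := {ffun 'I_N -> 'I_(m.*2.+1)}.

Definition node h m (k : idx m) : 'rV[R]_N := \row_i (h * ((k i)%:R - m%:R)).

(** For nonzero [h] the argument in each coordinate is that of [x - node h k] divided by [h],
    written as a quotient plus a constant so that [is_derive_bump] applies. *)
Definition weight h m (k : idx m) x : R :=
  \prod_(j < N) bump (x 0 j / h + (m%:R - (k j)%:R)).

Definition dweight h m (k : idx m) (i : 'I_N) x : R :=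
  \prod_(j < N) (if j == i then dbump (x 0 j / h + (m%:R - (k j)%:R)) / h
    else bump (x 0 j / h + (m%:R - (k j)%:R))).

Definition grid h m a x : R := \sum_(k : idx m) a (node h k) * weight h k x.

Definition dgrid h m a (i : 'I_N) x : R :=
  \sum_(k : idx m) a (node h k) * dweight h k i x.

Lemma C1_grid h m a : C1_with (grid h m a) (dgrid h m a).
Proof.
apply: C1_sum => k; apply: C1Z.
have C := @C1_prod_coord R N (index_enum 'I_N)
  (fun j t => bump (t / h + (m%:R - (k j)%:R)))
  (fun j t => dbump (t / h + (m%:R - (k j)%:R)) / h) (index_enum_uniq _)
  (fun j t => is_derive_bump h _ t) (fun j => @dbump_continuous R h _).
by apply: C1_with_ext C _ _ => // i x; rewrite mem_index_enum mul1r.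
Qed.

Lemma weight_ge0 h m (k : idx m) x : 0 <= weight h k x.
Proof. by apply: prodr_ge0 => j _; exact: bump_ge0. Qed.

Lemma node_close h m (k : idx m) x : 0 < h ->
  (forall j, `|x 0 j / h + (m%:R - (k j)%:R)| <= 2) -> `|node h k - x| <= 2 * h.
Proof.
move=> h0 H; apply: norm_le_coord => [|i]; first by lra.
rewrite !mxE; have := H i.
have -> : h * ((k i)%:R - m%:R) - x 0 i = - (h * (x 0 i / h + (m%:R - (k i)%:R))).
  by field; rewrite gt_eqF.
rewrite normrN normrM gtr0_norm// => Hi.
by rewrite mulrC ler_wpM2r// ltW.
Qed.

Lemma weight_far h m (k : idx m) x : 0 < h -> 2 * h < `|node h k - x| ->
  weight h k x = 0 /\ forall i, dweight h k i x = 0.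
Proof.
move=> h0 kx.
have [j jP] : exists j, 2 < `|x 0 j / h + (m%:R - (k j)%:R)|.
  apply/not_existsP => H; move: kx; rewrite ltNge => /negP; apply.
  by apply: node_close => // j; rewrite leNgt; apply/negP; exact: H.
have [b1 b2] := bump_support jP.
split; first by rewrite /weight (bigD1 j)//= b1 mul0r.
by move=> i; rewrite /dweight (bigD1 j)//= b1 b2; case: ifP; rewrite !mul0r.
Qed.

Lemma grid_far h m a x : 0 < h ->
  (forall k : idx m, `|node h k - x| <= 2 * h -> a (node h k) = 0) ->
  grid h m a x = 0 /\ forall i, dgrid h m a i x = 0.
Proof.
move=> h0 H; split=> [|i]; apply: big1 => k _;
have [/H->|/(weight_far h0)[w d]] := lerP `|node h k - x| (2 * h);
by rewrite ?mul0r ?w ?d ?mulr0.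
Qed.

Section in_box.
Variables (h : R) (m : nat) (x : 'rV[R]_N).
Hypotheses (h0 : 0 < h) (xbox : `|x| <= h * (m%:R - 1)).

Let z i := x 0 i / h + m%:R.

(** In the box, the finitely many nodes in each direction already give the full partition of
    unity. *)
Let zb i : 1 <= z i <= (m.*2.+1)%:R - 1.
Proof.
have : `|x 0 i / h| <= m%:R - 1.
  rewrite normrM normfV (gtr0_norm h0) ler_pdivrMr// mulrC.
  by apply: le_trans xbox; exact: coord_le_norm.
have -> : (m.*2.+1)%:R = m%:R + m%:R + 1 :> R by rewrite -addnn -addn1 !natrD.
rewrite ler_norml /z => /andP[? ?].
by apply/andP; split; lra.
Qed.

(** By distributivity the sum of products over all multi-indices is the product of the
    one-dimensional sums. *)
Lemma sum_weight : \sum_(k : idx m) weight h k x = 1.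
Proof.
rewrite /weight -(@bigA_distr_bigA _ _ _ _ _ _ _
  (fun j (k : 'I__) => bump (x 0 j / h + (m%:R - k%:R)))).
apply: big1 => j _; under eq_bigr do rewrite addrA.
exact: (sum_bump (zb j)).
Qed.

Lemma sum_dweight i : \sum_(k : idx m) dweight h k i x = 0.
Proof.
rewrite /dweight -(@bigA_distr_bigA _ _ _ _ _ _ _ (fun j (k : 'I__) => if j == i then
  dbump (x 0 j / h + (m%:R - k%:R)) / h else bump (x 0 j / h + (m%:R - k%:R)))).
rewrite (bigD1 i)//= eqxx.
under eq_bigr do rewrite addrA.
rewrite [X in X * _](_ : _ = 0) ?mul0r//.
by rewrite -mulr_suml (sum_dbump (zb i)) mul0r.
Qed.

(** The sum factors over the coordinates: direction [i] contributes at most [2 / h] and every other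
    direction exactly 1. *)
Lemma sum_norm_dweight i : \sum_(k : idx m) `|dweight h k i x| <= 2 / h.
Proof.
have -> : \sum_(k : idx m) `|dweight h k i x| =
  \sum_(k : idx m) \prod_(j < N) (if j == i then `|dbump (x 0 j / h + (m%:R - (k j)%:R))| / h
    else bump (x 0 j / h + (m%:R - (k j)%:R))).
  apply: eq_bigr => k _; rewrite /dweight normr_prod; apply: eq_bigr => j _.
  case: ifP => _; last by rewrite ger0_norm// bump_ge0.
  by rewrite normrM normfV (gtr0_norm h0).
rewrite -(@bigA_distr_bigA _ _ _ _ _ _ _ (fun j (k : 'I__) => if j == i then
  `|dbump (x 0 j / h + (m%:R - k%:R))| / h else bump (x 0 j / h + (m%:R - k%:R)))).
rewrite (bigD1 i)//= eqxx.
rewrite [X in _ * X]big1 => [|j ji].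
  rewrite mulr1 -mulr_suml; apply: ler_wpM2r; first by rewrite invr_ge0 ltW.
  by under eq_bigr do rewrite addrA; exact: sum_norm_dbump.
rewrite (negbTE ji).
under eq_bigr do rewrite addrA; exact: (sum_bump (zb j)).
Qed.

(** The weights sum to 1 and their derivatives to 0, so [c] may be subtracted from every nodal
    value; nodes farther than [2 * h] from [x] have zero weight. *)
Lemma grid_close a (c o : R) :
  (forall k : idx m, `|node h k - x| <= 2 * h -> `|a (node h k) - c| <= o) -> 0 <= o ->
  `|grid h m a x - c| <= o /\ forall i, `|dgrid h m a i x| <= 2 / h * o.
Proof.
move=> H o0; split=> [|i].
  have -> : grid h m a x - c = \sum_(k : idx m) (a (node h k) - c) * weight h k x.
    under [RHS]eq_bigr do rewrite mulrBl.
    by rewrite sumrB -mulr_sumr sum_weight mulr1.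
  apply: le_trans (ler_norm_sum _ _ _) _.
  rewrite -[leRHS]mulr1 -sum_weight mulr_sumr; apply: ler_sum => k _.
  rewrite normrM (ger0_norm (weight_ge0 _ _ _)).
  have [/H ac|/(weight_far h0)[-> _]] := lerP `|node h k - x| (2 * h).
    by rewrite ler_wpM2r// weight_ge0.
  by rewrite !mulr0.
have -> : dgrid h m a i x = \sum_(k : idx m) (a (node h k) - c) * dweight h k i x.
  under [RHS]eq_bigr do rewrite mulrBl.
  by rewrite sumrB -mulr_sumr sum_dweight mulr0 subr0.
apply: le_trans (ler_norm_sum _ _ _) _.
apply: le_trans (_ : \sum_(k : idx m) o * `|dweight h k i x| <= _); last first.
  by rewrite -mulr_sumr mulrC ler_wpM2r// sum_norm_dweight.
apply: ler_sum => k _; rewrite normrM.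
have [/H ac|/(weight_far h0)[_ ->]] := lerP `|node h k - x| (2 * h).
  by rewrite ler_wpM2r.
by rewrite normr0 !mulr0.
Qed.

End in_box.
End grid_operator.
(** * Whitney extension with zero gradient *)

Lemma geometric_increments_cvg (R : realType) (a : nat -> R) (K q : R) :
  0 <= K -> 0 <= q < 1 -> (forall n, `|a n.+1 - a n| <= K * q ^+ n) ->
  (forall n m, (n <= m)%N -> `|a m - a n| <= K / (1 - q) * q ^+ n) /\
  a @ \oo --> limn a.
Proof.
move=> K0 /andP[q0 q1] H; split.
  move=> n m /subnK <-; set d := (m - n)%N.
  have q1' : 0 < 1 - q by rewrite subr_gt0.
  (* The exact partial geometric sum makes the induction on [d] go through. *)
  suff : `|a (d + n)%N - a n| <= K / (1 - q) * (q ^+ n - q ^+ (d + n)%N).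
    move=> /le_trans; apply; rewrite ler_wpM2l// ?divr_ge0 ?(ltW q1')//.
    by rewrite lerBlDr lerDl exprn_ge0.
  elim: d => [|d IH]; first by rewrite !subrr normr0 mulr0.
  have -> : a (d.+1 + n)%N - a n = (a (d + n).+1 - a (d + n)%N) + (a (d + n)%N - a n).
    by rewrite addSn; ring.
  apply: le_trans (ler_normD _ _) _; apply: le_trans (lerD (H _) IH) _.
  rewrite addSn exprS le_eqVlt; apply/orP; left; apply/eqP; field.
  by rewrite gt_eqF.
pose u n := a n.+1 - a n.
have cu : cvgn (series u).
  apply: normed_cvg.
  apply: (@series_le_cvg _ _ (geometric K q)) => [n|n|n|] //.
  - exact: normr_ge0.
  - by apply: mulr_ge0 => //; exact: exprn_ge0.
  - exact: H.
  - by apply: is_cvg_geometric_series; rewrite ger0_norm.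
suff : cvgn a by [].
have -> : a = (fun n => series u n + a 0%N).
  apply/funext => n; rewrite /series /= big_mkord -(big_mkord predT u) telescope_sumr//.
  by rewrite subrK.
by apply: is_cvgD => //; exact: is_cvg_cst.
Qed.

Section Whitney_extension.
Variables (R : realType) (N : nat) (L : set 'rV[R]_N) (f : 'rV[R]_N -> R) (t M : R).
Hypotheses (L0 : L !=set0) (cL : compact L) (t1 : 1 < t) (M0 : 0 < M).
Hypothesis hf : forall x y, L x -> L y -> `|f x - f y| <= M * `|x - y| `^ t.

(* [u] is [f] at a nearest point of [L]; it need not be continuous, as it is
   only ever sampled at grid nodes. *)
Lemma nearest_point_extension : exists u : 'rV[R]_N -> R, forall x e, L e ->
  `|u x - f e| <= M * 2 `^ t * `|x - e| `^ t.
Proof.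
suff /choice[p pP] : forall x, exists p, L p /\ forall e, L e -> `|x - p| <= `|x - e|.
  exists (f \o p) => x e Le /=; have [Lp px] := pP x.
  apply: le_trans (hf Lp Le) _; rewrite -mulrA ler_pM2l// -powRM//.
  have t0 : 0 <= t := ltW (lt_trans ltr01 t1).
  apply: ge0_ler_powR; rewrite ?nnegrE ?mulr_ge0//.
  have -> : p x - e = (x - e) - (x - p x) by rewrite [RHS]addrC opprB subrKA.
  apply: le_trans (ler_normB _ _) _; have := px _ Le; lra.
move=> x; have cn : {within L, continuous (fun y : 'rV[R]_N => `|x - y|)}.
  apply: continuous_subspaceT => y.
  apply: (@cvg_norm _ _ _ _ (nbhs_filter y)).
  by apply: (@cvgB _ _ _ _ (nbhs_filter y)); [exact: (@cvg_cst _ _ _ _ (nbhs_filter y))|exact: cvg_id].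
have [c cLc cP] := EVT_min_rV L0 cL cn.
exists c; split; first by rewrite inE in cLc.
by move=> e Le; apply: cP; rewrite inE.
Qed.

(* With [Q j] the smoothing of [u] at scale [h j = 2 ^- j] and [X j] a cut-off equal
   to 1 near [L] and supported at distance [O(h j)] from [L], the extension is
   [Q 0 + \sum_j X j * (Q j.+1 - Q j)]; the gradient of the [j]-th term is
   [O(h j `^ (t - 1))], and the partial sums equal [Q n] on [L]. *)
Lemma Whitney_extension : exists F, [/\ C1 F,
  forall x, L x -> F x = f x & forall x, L x -> gradient F x = 0].
Proof.
have [u uP] := nearest_point_extension.
set C := M * 2 `^ t in uP.
have C0 : 0 <= C by rewrite mulr_ge0 ?powR_ge0// ltW.
have [B B0 LB] : exists2 B, 0 < B & forall x, L x -> `|x| < B.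
  by have [B B0 BP] := ex_strict_bound_gt0 (compact_bounded cL); exists B => // x /BP.
pose h j : R := 2^-1 ^+ j.
have h0 j : 0 < h j by rewrite exprn_gt0// invr_gt0.
have h1 j : h j <= 1 by rewrite exprn_ile1// ?invr_ge0// invf_le1// ler1n.
have hS j : h j.+1 = h j / 2 by rewrite /h exprS mulrC.
(* At every scale the box has to contain all points within distance 6 of [L]. *)
have /choice[m mP] : forall j, exists m : nat, B + 6 <= h j * (m%:R - 1).
  move=> j; pose b := Num.bound ((B + 6) / h j); exists b.+1.
  rewrite -[b.+1]addn1 natrD addrK mulrC -ler_pdivrMr// ltW// archi_boundP//.
  by rewrite divr_ge0 ?(ltW (h0 _))//; lra.
(* Only nodes within [2 * h j] of a point influence the smoothing there. Marking the nodes within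
   [4 * h j] of [L] thus makes [X j] equal to 1 on [L], with zero gradient, and 0 beyond distance
   [6 * h j]. *)
pose near j (y : 'rV[R]_N) := exists2 e, L e & `|y - e| <= 4 * h j.
pose cut j (y : 'rV[R]_N) : R := if `[< near j y >] then 1 else 0.
pose Q j := grid (h j) (m j) u.
pose dQ j := dgrid (h j) (m j) u.
pose X j := grid (h j) (m j) (cut j).
pose dX j := dgrid (h j) (m j) (cut j).
have C1Q j : C1_with (Q j) (dQ j) by exact: C1_grid.
have C1X j : C1_with (X j) (dX j) by exact: C1_grid.
pose D j x := X j x * (Q j.+1 x - Q j x).
pose dD j i x := dX j i x * (Q j.+1 x - Q j x) + X j x * (dQ j.+1 i x - dQ j i x).
have C1term j : C1_with (D j) (dD j) by apply: C1M => //; apply: C1B.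
(* [q ^+ j] is the power of [h j] with exponent [t - 1]; [1 < t] gives [q < 1]. *)
pose q : R := 2^-1 `^ (t - 1).
have q01 : 0 <= q < 1.
  rewrite powR_ge0 /= /q /powR gt_eqF ?invr_gt0// expR_lt1//.
  rewrite pmulr_rlt0 ?subr_gt0// ln_lt0// invr_gt0 ltr0n /=.
  by rewrite invf_lt1// ltr1n.
have q0 n : 0 <= q ^+ n by rewrite exprn_ge0// (andP q01).1.
(* The 8 is [2 + 6]: a node within [2 * h j] of [x], itself within [6 * h j] of [L]. One factor
   [h j] is kept apart to cancel the [2 / h j] from differentiating the weights. *)
pose K := C * 8 `^ t.
have K0 : 0 <= K by rewrite mulr_ge0// powR_ge0.
have oE j : C * (8 * h j) `^ t = K * h j * q ^+ j.
  rewrite powRM// ?(ltW (h0 j))// /K -!mulrA; congr (_ * (_ * _)).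
  rewrite -(@mulr_powRB1 _ (h j) t) ?(ltW (h0 j))//; last exact: lt_trans ltr01 t1.
  congr (_ * _); rewrite /h /q -powR_mulrn ?invr_ge0// powRAC powR_mulrn//.
have uclose j x e y : L e -> `|x - e| <= 6 * h j -> `|y - x| <= 2 * h j ->
    `|u y - f e| <= K * h j * q ^+ j.
  move=> Le xe yx; apply: le_trans (uP y e Le) _; rewrite -oE ler_wpM2l//.
  have t0 : 0 <= t := ltW (lt_trans ltr01 t1).
  apply: ge0_ler_powR; rewrite ?nnegrE ?mulr_ge0 ?(ltW (h0 j))//.
  have -> : y - e = (y - x) + (x - e) by rewrite subrKA.
  apply: le_trans (ler_normD _ _) _; lra.
have box j j' x e : L e -> `|x - e| <= 6 * h j' -> `|x| <= h j * ((m j)%:R - 1).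
  move=> Le xe; apply: le_trans (mP j).
  have -> : x = (x - e) + e by rewrite subrK.
  apply: le_trans (ler_normD _ _) _; have := LB _ Le; have := h1 j'; lra.
have o0 j : 0 <= K * h j * q ^+ j by rewrite !mulr_ge0// ltW.
have Kh j : K * h j * q ^+ j <= K * q ^+ j.
  by apply: ler_wpM2r => //; rewrite -[leRHS]mulr1; apply: ler_wpM2l (h1 j).
have Qclose j x e : L e -> `|x - e| <= 6 * h j ->
    `|Q j x - f e| <= K * h j * q ^+ j /\ forall i, `|dQ j i x| <= 2 * K * q ^+ j.
  move=> Le xe.
  have [||a b] := @grid_close R N (h j) (m j) x (h0 j) _ u (f e) (K * h j * q ^+ j) _ (o0 j).
  - exact: box Le xe.
  - by move=> k kx; apply: uclose Le xe kx.
  split=> // i; apply: le_trans (b i) _; rewrite le_eqVlt; apply/orP; left; apply/eqP.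
  by field; rewrite gt_eqF.
have QSclose j x e : L e -> `|x - e| <= 6 * h j ->
    `|Q j.+1 x - f e| <= K * h j * q ^+ j /\ forall i, `|dQ j.+1 i x| <= 4 * K * q ^+ j.
  move=> Le xe.
  have [||a b] := @grid_close R N (h j.+1) (m j.+1) x (h0 j.+1) _ u (f e) (K * h j * q ^+ j) _ (o0 j).
  - exact: box Le xe.
  - move=> k kx; apply: uclose Le xe _; apply: le_trans kx _.
    by rewrite hS; have := h0 j; lra.
  split=> // i; apply: le_trans (b i) _; rewrite le_eqVlt; apply/orP; left; apply/eqP.
  by rewrite hS; field; rewrite gt_eqF.
(* The 10 is [4 + 6]: [2 / h j] times [2 * K * h j * q ^+ j] from the gradient of [X j], and
   [6 * K * q ^+ j] from the gradients of the two smoothings. *)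
have Dbound j x : `|D j x| <= 2 * K * q ^+ j /\ forall i, `|dD j i x| <= 10 * K * q ^+ j.
  have [[e Le xe]|far] := pselect (exists2 e, L e & `|x - e| <= 6 * h j).
    have [a1 a2] := Qclose _ _ _ Le xe; have [b1 b2] := QSclose _ _ _ Le xe.
    have [||c1 c2] := @grid_close R N (h j) (m j) x (h0 j) _ (cut j) 0 1 _ ler01.
    - exact: box Le xe.
    - by move=> k _; rewrite subr0 /cut; case: ifP => _; rewrite ?normr1 ?normr0.
    rewrite subr0 in c1.
    have d1 : `|Q j.+1 x - Q j x| <= 2 * (K * h j * q ^+ j).
      have -> : Q j.+1 x - Q j x = (Q j.+1 x - f e) - (Q j x - f e) by ring.
      apply: le_trans (ler_normB _ _) _; lra.
    have d2 i : `|dQ j.+1 i x - dQ j i x| <= 6 * K * q ^+ j.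
      apply: le_trans (ler_normB _ _) _; have := a2 i; have := b2 i; lra.
    split=> [|i].
      rewrite /D normrM -[leRHS]mul1r; apply: ler_pM => //.
      by apply: le_trans d1 _; rewrite -[leRHS]mulrA; apply: ler_wpM2l (Kh j).
    rewrite /dD; apply: le_trans (ler_normD _ _) _; rewrite !normrM.
    apply: le_trans (lerD (ler_pM _ _ (c2 i) d1) (ler_pM _ _ c1 (d2 i))) _ => //.
    rewrite le_eqVlt; apply/orP; left; apply/eqP.
    by field; rewrite gt_eqF.
  have [|z1 z2] := @grid_far R N (h j) (m j) (cut j) x (h0 j).
    move=> k kx; rewrite /cut; case: asboolP => // -[e Le ke].
    exfalso; apply: far; exists e => //.
    have -> : x - e = (node (h j) k - e) - (node (h j) k - x) by rewrite [RHS]addrC opprB subrKA.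
    by apply: le_trans (ler_normB _ _) _; lra.
  rewrite /D /dD /X /dX z1; split=> [|i]; rewrite ?z2 !mul0r ?addr0 normr0;
  by apply: mulr_ge0; rewrite ?q0// mulr_ge0.
pose S n x := Q 0%N x + \sum_(j < n) D j x.
pose dS n i x := dQ 0%N i x + \sum_(j < n) dD j i x.
have C1S n : C1_with (S n) (dS n).
  apply: C1D => //.
  by apply: (@C1_sum _ _ _ _ (fun j : 'I_n => D j) (fun j : 'I_n => dD j)) => j.
have Scauchy x := @geometric_increments_cvg R (S ^~ x) (2 * K) q (mulr_ge0 (ler0n _ 2) K0) q01.
have dScauchy x i := @geometric_increments_cvg R (fun n => dS n i x) (10 * K) q
  (mulr_ge0 (ler0n _ 10) K0) q01.
have Sinc x n : S n.+1 x - S n x = D n x by rewrite /S big_ord_recr /=; ring.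
have dSinc i x n : dS n.+1 i x - dS n i x = dD n i x by rewrite /dS big_ord_recr /=; ring.
have Slim x : S ^~ x @ \oo --> limn (S ^~ x).
  by apply: (Scauchy x _).2 => n; rewrite Sinc; exact: (Dbound n x).1.
have dSinc' i x n : `|dS n.+1 i x - dS n i x| <= 10 * K * q ^+ n.
  by rewrite dSinc; exact: (Dbound n x).2.
have C1F : C1_with (fun x => limn (S ^~ x)) (fun i x => limn (fun n => dS n i x)).
  apply: (C1_limit (E := geometric (10 * K / (1 - q)) q) C1S) => //.
  - by apply: cvg_geometric; rewrite ger0_norm; case/andP: q01.
  - by move=> n n' i x nn'; exact: (dScauchy x i (dSinc' i x)).1.
  - by move=> i x; exact: (dScauchy x i (dSinc' i x)).2.
have geo_lim (a : nat -> R) l A : (forall n, `|a n - l| <= A * q ^+ n) -> limn a = l.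
  move=> al; apply: cvg_lim => //; apply/cvgrPdist_le => e e0.
  have : geometric A q @ \oo --> 0 by apply: cvg_geometric; rewrite ger0_norm; case/andP: q01.
  move/cvgrPdist_le => /(_ e e0); apply: filterS => n /=; rewrite sub0r normrN distrC => Ae.
  exact: le_trans (al n) (le_trans (ler_norm _) Ae).
have Xone j x : L x -> X j x = 1 /\ forall i, dX j i x = 0.
  move=> Lx.
  have [|||c1 c2] := @grid_close R N (h j) (m j) x (h0 j) _ (cut j) 1 0 _.
  - by apply: (box j j x x Lx); rewrite subrr normr0; have := h0 j; lra.
  - move=> k kx; rewrite /cut asboolT ?subrr ?normr0//.
    by exists x => //; have := h0 j; lra.
  - by [].
  split=> [|i]; apply/eqP.
    by rewrite -subr_eq0 -normr_le0.
  by rewrite -normr_le0 (le_trans (c2 i))// mulr0.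
have SQ n x : L x -> S n x = Q n x /\ forall i, dS n i x = dQ n i x.
  move=> Lx; elim: n => [|n [IH1 IH2]].
    by rewrite /S /dS; split=> [|i]; rewrite big_ord0 addr0.
  have [X1 dX1] := Xone n x Lx; split=> [|i].
    by apply/eqP; rewrite -(subrK (S n x) (S n.+1 x)) Sinc /D X1 IH1 mul1r subrK.
  apply/eqP; rewrite -(subrK (dS n i x) (dS n.+1 i x)) dSinc /dD X1 dX1 IH2.
  by rewrite mul0r add0r mul1r subrK.
have x6 (x : 'rV[R]_N) j : `|x - x| <= 6 * h j by rewrite subrr normr0; have := h0 j; lra.
exists (fun x => limn (S ^~ x)); split; first exact: C1_withE C1F.
- move=> x Lx; apply: (@geo_lim _ _ K) => n; rewrite (SQ n x Lx).1.
  exact: le_trans (Qclose n x x Lx (x6 x n)).1 (Kh n).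
- move=> x Lx; apply/rowP => i; rewrite (C1_with_gradient x i C1F) mxE.
  apply: (@geo_lim _ _ (2 * K)) => n; rewrite (SQ n x Lx).2 subr0.
  exact: (Qclose n x x Lx (x6 x n)).2.
Qed.

End Whitney_extension.
(** * Similitudes and Hausdorff measure *)

Section euclidean_norm.
Variables (R : realType) (N : nat).
Implicit Types x y : 'rV[R]_N.

Lemma enorm_ge0 x : 0 <= enorm x.
Proof. exact: sqrtr_ge0. Qed.

Lemma norm_le_enorm x : `|x| <= enorm x.
Proof.
apply: norm_le_coord => [|i]; first exact: enorm_ge0.
rewrite -sqrtr_sqr /enorm ler_wsqrtr// (bigD1 i)//= lerDl.
by apply: sumr_ge0 => j _; exact: sqr_ge0.
Qed.

(** The crude constant [N.+1] is positive even for [N = 0], so that it can be divided by. *)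
Lemma enorm_le_norm x : enorm x <= N.+1%:R * `|x|.
Proof.
rewrite -[leRHS]ger0_norm ?mulr_ge0// -sqrtr_sqr /enorm ler_wsqrtr//.
apply: le_trans (_ : \sum_(i < N) `|x| ^+ 2 <= _).
  apply: ler_sum => i _; rewrite -[leLHS]real_normK ?num_real//.
  by rewrite ler_sqr ?nnegrE//; exact: coord_le_norm.
rewrite sumr_const card_ord -[leLHS]mulr_natl exprMn; apply: ler_wpM2r; first exact: sqr_ge0.
by rewrite -natrX ler_nat (leq_trans (leqnSn N))// leq_pmulr.
Qed.

Lemma enorm_sub_gt0 x y : x <> y -> 0 < enorm (x - y).
Proof.
move=> /eqP xy; apply: lt_le_trans (norm_le_enorm _).
by rewrite normr_gt0 subr_eq0.
Qed.

Lemma enorm0 : enorm (0 : 'rV[R]_N) = 0.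
Proof. by rewrite /enorm big1 ?sqrtr0// => i _; rewrite mxE expr0n. Qed.

End euclidean_norm.

Lemma within_continuous_epsP (R : realType) (V W : normedModType R) (A : set V)
    (f : V -> W) :
  {within A, continuous f} <-> forall x, A x -> forall e, 0 < e ->
    exists2 d, 0 < d & forall y, A y -> `|x - y| < d -> `|f x - f y| < e.
Proof.
split=> [/subspace_continuousP cf x Ax e e0|H].
  have /(@cvgrPdist_lt _ _ _ _ (within_filter A (nbhs_filter x)))/(_ e e0) := cf x Ax.
  rewrite /prop_near1 /within /= => /nbhs_normP[d /= d0 dP].
  by exists d => // y Ay xy; apply: dP.
apply/subspace_continuousP => x Ax.
apply/(@cvgrPdist_lt _ _ _ _ (within_filter A (nbhs_filter x))) => e e0.
have [d d0 dP] := H x Ax e e0.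
rewrite /prop_near1 /within /=; apply/nbhs_normP; exists d => //= y xy Ay; exact: dP.
Qed.

(** * Iterated systems of similitudes *)

Section similitudes.
Variables (R : realType) (N : nat).
Implicit Types (T S : 'rV[R]_N -> 'rV[R]_N) (L : set 'rV[R]_N).

Definition similitude (rho : R) T : Prop :=
  0 < rho /\ forall x y, enorm (T x - T y) = rho * enorm (x - y).

Lemma similitude_inj rho T : similitude rho T -> injective T.
Proof.
move=> [rho0 TP] x y Txy; apply: contrapT => xy; have := enorm_sub_gt0 xy.
rewrite -(pmulr_rgt0 _ rho0) -TP Txy subrr enorm0 ltxx//.
Qed.

Lemma similitude_comp a b T S :
  similitude a T -> similitude b S -> similitude (a * b) (T \o S).
Proof.
move=> [a0 Ta] [b0 Sb]; split=> [|x y]; first exact: mulr_gt0.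
by rewrite /= Ta Sb mulrA.
Qed.

(** Treats touching and disjoint pieces alike. *)
Definition at_most_one (A B : set 'rV[R]_N) : Prop :=
  forall p q, A p -> B p -> A q -> B q -> p = q.

(** [J] stands for the words of length [n], built by prepending a letter. Distinct words with the
    same first letter are separated by induction and injectivity; otherwise their pieces lie in
    distinct first-level pieces. *)
Lemma iterated_system (l : nat) (S : 'I_l -> 'rV[R]_N -> 'rV[R]_N) (r : 'I_l -> R)
    (rm : R) L :
  (forall i, similitude (r i) (S i)) -> (forall i, r i <= rm) ->
  L = \bigcup_(i : 'I_l) (S i @` L) ->
  (forall i j, i != j -> at_most_one (S i @` L) (S j @` L)) ->
  forall n, exists (J : finType) (T : J -> 'rV[R]_N -> 'rV[R]_N) (rho : J -> R),
  [/\ (forall j, similitude (rho j) (T j) /\ rho j <= rm ^+ n),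
      (forall j, T j @` L `<=` L),
      L `<=` \bigcup_j (T j @` L),
      (forall t, \sum_j rho j `^ t = (\sum_i r i `^ t) ^+ n) &
      (forall j j', j != j' -> at_most_one (T j @` L) (T j' @` L))].
Proof.
move=> hS rmP LE amo; elim=> [|n [J [T [rho [sT TL LT sumT amoT]]]]].
  exists unit, (fun=> id), (fun=> 1); split.
  - by move=> _; split; [split=> // x y; rewrite mul1r|rewrite expr0].
  - by move=> _ x [y Ly <-].
  - by move=> x Lx; exists tt => //; exists x.
  - by move=> t; rewrite expr0 powR1 sumr_const card_unit.
  - by case; case.
have SL i : S i @` L `<=` L by rewrite {2}LE; move=> x Sx; exists i.
exists ('I_l * J)%type, (fun k => S k.1 \o T k.2), (fun k => r k.1 * rho k.2); split.
- move=> [i j] /=; have [sj rj] := sT j; split; first exact: similitude_comp.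
  by rewrite exprS; apply: ler_pM => //; apply: ltW; [exact: (hS i).1|exact: sj.1].
- move=> [i j] x [y Ly <-] /=; apply: (SL i); exists (T j y) => //.
  by apply: (TL j); exists y.
- move=> x; rewrite {1}LE => -[i _ [y /LT[j _ [z Lz <-]] <-]].
  by exists (i, j) => //; exists z.
- move=> t; rewrite exprS -sumT big_distrlr/= pair_big/=.
  apply: eq_bigr => -[i j] _ /=; rewrite powRM//; apply: ltW.
    exact: (hS i).1.
  exact: (sT j).1.1.
- move=> [i j] [i' j'] /= neq p q [x Lx <-] [x' Lx' E] [y Ly <-] [y' Ly' E'].
  have [ii|ii] := eqVneq i i'.
    subst i'; have jj : j != j' by apply: contra_neq neq => ->.
    have inj := similitude_inj (hS i).
    congr (S i); apply: (amoT _ _ jj).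
    + by exists x.
    + by exists x' => //; exact: inj.
    + by exists y.
    + by exists y' => //; exact: inj.
  apply: (amo _ _ ii).
  + by exists (T j x) => //; apply: (TL j); exists x.
  + by exists (T j' x') => //; apply: (TL j'); exists x'.
  + by exists (T j y) => //; apply: (TL j); exists y.
  + by exists (T j' y') => //; apply: (TL j'); exists y'.
Qed.

End similitudes.

(** * Coverings and Hausdorff measure *)

Section hausdorff_bounds.
Variables (R : realType) (N : nat).
Implicit Types (E U : set 'rV[R]_N).

Lemma ediam_ge0 U : (0 <= ediam U)%E.
Proof. by apply: ereal_sup_ubound; left. Qed.

Lemma enorm_le_ediam U x y : U x -> U y -> ((enorm (x - y))%:E <= ediam U)%E.
Proof. by move=> Ux Uy; apply: ereal_sup_ubound; right; exists (x, y). Qed.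

Lemma hgauge_ge0 t U : (0 <= hgauge t U)%E.
Proof. by rewrite /hgauge; case: ifP => // _; exact: poweR_ge0. Qed.

Lemma ediam_le U (d : R) : 0 <= d -> (forall x y, U x -> U y -> enorm (x - y) <= d) ->
  (ediam U <= d%:E)%E.
Proof.
move=> d0 H; apply: ge_ereal_sup => _ [->|[[x y] [/= Ux Uy] <-]]; rewrite lee_fin//.
exact: H.
Qed.

Lemma hgauge_le t U (d : R) : 0 <= t -> 0 <= d -> U !=set0 -> (ediam U <= d%:E)%E ->
  (hgauge t U <= (d `^ t)%:E)%E.
Proof.
move=> t0 d0 U0 Ud; rewrite /hgauge; case: ifP => [/eqP E|_].
  by move: U0; rewrite E => -[].
rewrite -poweR_EFin; have := ediam_ge0 U; move: Ud; case: (ediam U) => [e| |]//=.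
rewrite !lee_fin => ed e0.
by apply: ge0_ler_powR; rewrite ?nnegrE.
Qed.

Lemma hausdorff_premeasure_ge0 t delta E : (0 <= hausdorff_premeasure t delta E)%E.
Proof.
apply: le_ereal_inf_tmp => _ [U _ <-]; apply: nneseries_ge0 => k _ _; exact: hgauge_ge0.
Qed.

(** The level [n] pieces have diameter at most [D * rm ^+ n], and their gauges sum to at most a
    constant times [q ^+ n]; both bounds tend to 0. *)
Lemma self_similar_hausdorff_measure0 (l : nat) (S : 'I_l -> 'rV[R]_N -> 'rV[R]_N)
    (r : 'I_l -> R) (rm D t : R) (L : set 'rV[R]_N) :
  L !=set0 -> (forall i, similitude (r i) (S i)) -> (forall i, r i <= rm) ->
  0 <= rm < 1 -> 0 < D -> (forall x y, L x -> L y -> enorm (x - y) <= D) ->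
  L = \bigcup_(i : 'I_l) (S i @` L) ->
  (forall i j, i != j -> at_most_one (S i @` L) (S j @` L)) ->
  0 <= t -> \sum_i r i `^ t < 1 -> hausdorff_measure t L = 0%E.
Proof.
move=> L0 hS rmP /andP[rm0 rm1] D0 LD LE amo t0 sum1.
set q := \sum_i r i `^ t in sum1.
have q0 : 0 <= q by apply: sumr_ge0 => i _; exact: powR_ge0.
have geo0 z c (e : R) : 0 <= z < 1 -> 0 < e -> \forall n \near \oo, c * z ^+ n <= e.
  move=> /andP[z0 z1] e0.
  have : geometric c z @ \oo --> 0 by apply: cvg_geometric; rewrite ger0_norm.
  move/cvgrPdist_le => /(_ e e0); apply: filterS => n /=.
  by rewrite sub0r normrN; apply: le_trans; exact: ler_norm.
apply/eqP; rewrite eq_le; apply/andP; split; last first.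
  apply: le_trans (hausdorff_premeasure_ge0 t 1 L) _.
  by apply: ereal_sup_ubound; exists 1 => //=.
apply: ge_ereal_sup => _ [delta /= delta0 <-]; apply/lee_addgt0Pr => e e0; rewrite add0e.
have [n _ nP] : \forall n \near \oo, D * rm ^+ n <= delta /\ D `^ t * q ^+ n <= e.
  by apply: filterI; apply: geo0; rewrite ?rm0 ?q0.
have [/= n1 n2] := nP n (leqnn n).
have [J [T [rho [sT TL LT sumT _]]]] := iterated_system hS rmP LE amo n.
have rho0 j : 0 <= rho j by apply: ltW; exact: (sT j).1.1.
have TD j : (ediam (T j @` L) <= (rho j * D)%:E)%E.
  apply: ediam_le; first by rewrite mulr_ge0// ltW.
  move=> _ _ [x Lx <-] [y Ly <-]; rewrite (sT j).1.2 ler_wpM2l//; exact: LD.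
(* The finite cover is padded to a sequence with empty sets, whose gauge is 0. *)
pose s := [seq T j @` L | j <- enum J].
apply: le_trans (_ : (\sum_(0 <= k <oo) hgauge t (nth set0 s k) <= _)%E).
  apply: ereal_inf_lbound; exists (nth set0 s) => //; split.
    move=> x /LT[j _ Tx]; exists (index j (enum J)) => //=.
    rewrite (nth_map j); first by rewrite nth_index// mem_enum.
    by rewrite index_mem mem_enum.
  move=> k; have [ks|ks] := ltnP k (size s).
    have /mapP[j _ ->] := mem_nth set0 ks.
    apply: le_trans (TD j) _; rewrite lee_fin; apply: le_trans n1.
    by rewrite mulrC; apply: ler_wpM2l (sT j).2; exact: ltW.
  rewrite nth_default//; apply: ediam_le; [exact: ltW|by []].
rewrite (@nneseries_split _ _ 0%N (size s)); last by move=> *; exact: hgauge_ge0.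
rewrite add0n [X in (_ + X)%E]eseries0 ?adde0; last first.
  by move=> k ks _; rewrite nth_default// /hgauge eqxx.
rewrite -(big_nth set0 predT) big_map big_enum/=.
apply: le_trans (_ : (\sum_j ((rho j * D) `^ t)%:E <= _)%E).
  apply: lee_sum => j _; apply: hgauge_le => //.
  - by rewrite mulr_ge0// ltW.
  - by have [x Lx] := L0; exists (T j x); exists x.
rewrite sumEFin lee_fin; apply: le_trans n2.
under eq_bigr do rewrite powRM ?(ltW D0)//.
by rewrite -mulr_suml sumT mulrC.
Qed.

(** The image of [E] is an interval, and covers of [E] with small gauge sum become covers of that
    interval with small total length. *)
Lemma hoelder_connected_constant E (f : 'rV[R]_N -> R) (M r t : R) :
  connected E -> 0 < M -> 0 <= t < r -> hausdorff_measure t E = 0%E ->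
  (forall x y, E x -> E y -> `|f x - f y| <= M * enorm (x - y) `^ r) ->
  forall x y, E x -> E y -> f x = f y.
Proof.
move=> cE M0 /andP[t0 tr] H0 hf.
have r0 : 0 < r by exact: le_lt_trans tr.
have cf : {within E, continuous f}.
  apply/within_continuous_epsP => x Ex e e0.
  pose d := (e / M) `^ r^-1.
  have d0 : 0 < d by rewrite powR_gt0// divr_gt0.
  exists (d / N.+1%:R); first by rewrite divr_gt0.
  move=> y Ey xy; apply: le_lt_trans (hf _ _ Ex Ey) _.
  rewrite mulrC -ltr_pdivlMr//.
  have -> : e / M = d `^ r by rewrite /d -powRrM mulVf ?gt_eqF// powRr1// ltW// divr_gt0.
  apply: gt0_ltr_powR; rewrite ?nnegrE ?enorm_ge0 ?ltW//.
  by apply: le_lt_trans (enorm_le_norm _) _; rewrite mulrC -ltr_pdivlMr.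
have If : is_interval (f @` E) by apply/connected_intervalP; exact: connected_continuous_connected.
suff le x y : E x -> E y -> f y <= f x.
  by move=> x y Ex Ey; apply/eqP; rewrite eq_le !le.
move=> Ex Ey; apply/ler_addgt0Pr => e e0.
have Me : 0 < e / (2 * M) by rewrite divr_gt0// mulr_gt0.
have : (hausdorff_premeasure t 1 E < (e / (2 * M))%:E)%E.
  apply: le_lt_trans (_ : (0 < _)%E); last by rewrite lte_fin.
  by rewrite -H0; apply: ereal_sup_ubound; exists 1 => //=.
move=> /ereal_inf_lt[_ [U [EU U1] <-] sumU].
have /choice[c cP] : forall k, exists z, (E `&` U k) !=set0 -> (E `&` U k) z.
  move=> k; have [[z zP]|n] := pselect ((E `&` U k) !=set0).
    by exists z.
  by exists 0 => /n.
pose d k := fine (ediam (U k)).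
have dE k : ediam (U k) = (d k)%:E.
  have := ediam_ge0 (U k); have := U1 k; rewrite /d; by case: (ediam (U k)).
have d01 k : 0 <= d k <= 1 by rewrite -!lee_fin -dE ediam_ge0 U1.
(* This interval contains the values of [f] on the part of [U k] in [E]: the diameter is at most 1,
   so the exponent [r] may be lowered to [t]. Its length is [2 * M] times the gauge, which explains
   the threshold [e / (2 * M)]. *)
pose I k : set R := if pselect ((E `&` U k) !=set0) then
  `[f (c k) - M * d k `^ t, f (c k) + M * d k `^ t]%classic else set0.
have mI k : measurable (I k) by rewrite /I; case: pselect => ?; [exact: measurable_itv|exact: measurable0].
pose A : set R := [set` `[f x, f y]%R].
have leA : ((if (f x < f y)%R then ((f y)%:E - (f x)%:E)%E else 0%E) <= lebesgue_measure A)%E.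
  by rewrite /A lebesgue_measure_itv /= lte_fin.
have II : A `<=` \bigcup_k I k.
  move=> z; rewrite /A /= in_itv /= => zxy.
  have [w Ew <-] : (f @` E) z by apply: If zxy; [exists x|exists y].
  have [k _ Uk] := EU _ Ew; exists k => //; rewrite /I; case: pselect => [ne|n].
    have [Ec Uc] := cP _ ne.
    rewrite /= in_itv/= -ler_distl distrC; apply: le_trans (hf _ _ Ec Ew) _.
    rewrite ler_pM2l//.
    have := enorm_le_ediam Uc Uk; rewrite dE lee_fin => le1.
    apply: le_trans (_ : d k `^ r <= _).
      by apply: ge0_ler_powR; rewrite ?nnegrE ?enorm_ge0 ?(ltW r0)//; case/andP: (d01 k).
    have /andP[] := d01 k; rewrite le_eqVlt => /orP[/eqP <-|dk0] dk1.
      by rewrite powR0 ?gt_eqF// powR_ge0.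
    by apply: ger_powR (ltW tr); rewrite dk0.
  by exfalso; apply: n; exists w.
have := @measure_sigma_subadditive _ _ _ (@lebesgue_measure R) _ I mI _ II.
move=> /(_ (measurable_itv `[f x, f y]%R)) leb.
have leU : (\sum_(0 <= k <oo) lebesgue_measure (I k) <=
    \sum_(0 <= k <oo) ((2 * M)%:E * hgauge t (U k)))%E.
  apply: lee_nneseries => k; first by move=> _ _; exact: measure_ge0.
  move=> _; rewrite /I; case: pselect => [ne|n]; last first.
    by rewrite measure0 mule_ge0// ?hgauge_ge0// lee_fin mulr_ge0// ltW.
  rewrite /hgauge; case: ifP => [/eqP E0|_].
    by have [_ Uc] := cP _ ne; exfalso; move: Uc; rewrite E0.
  rewrite dE poweR_EFin -EFinM lebesgue_measure_itv /= lte_fin.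
  case: ifP => _; last by rewrite lee_fin !mulr_ge0 ?powR_ge0// ltW.
  by rewrite -EFinB lee_fin le_eqVlt; apply/orP; left; apply/eqP; ring.
have := le_trans leb leU; rewrite nneseriesZl; last by move=> k _; exact: hgauge_ge0.
move=> /(le_trans leA).
case: ltP => [fxy|fyx _]; last by rewrite (le_trans fyx)// lerDl ltW.
move=> H; have : ((f y - f x)%:E <= (2 * M)%:E * (e / (2 * M))%:E)%E.
  rewrite EFinB; apply: le_trans H _; apply: lee_wpmul2l; last exact: ltW.
  by rewrite lee_fin mulr_ge0// ltW.
rewrite -EFinM lee_fin mulrCA divff ?mulr1 ?gt_eqF ?mulr_gt0//.
by rewrite lerBlDr addrC.
Qed.

End hausdorff_bounds.
(** * Hoelder functions on a self-similar arc *)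

(** The reciprocal of 1 plus the sum of the reciprocals also serves when [J] is empty, unlike a
    minimum. *)
Lemma finite_positive_lower_bound (R : realType) (J : finType) (d : J -> R) :
  (forall j, 0 < d j) -> exists2 e, 0 < e & forall j, e <= d j.
Proof.
move=> d0; have s0 : 0 <= \sum_j (d j)^-1 by apply: sumr_ge0 => j _; rewrite invr_ge0 ltW.
exists (1 + \sum_j (d j)^-1)^-1 => [|j]; first by rewrite invr_gt0; lra.
rewrite -[leRHS]invrK lef_pV2 ?posrE ?invr_gt0//; last by lra.
rewrite (bigD1 j)//= addrCA lerDl addr_ge0// sumr_ge0// => i _.
by rewrite invr_ge0 ltW.
Qed.

(** * Subarcs as parameter intervals *)

Section arc.
Variables (R : realType) (N : nat) (L : set 'rV[R]_N).
Variables (gam : R -> 'rV[R]_N) (g : 'rV[R]_N -> R).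
Hypotheses (cL : compact L) (cgam : {within `[0, 1]%classic, continuous gam}).
Hypotheses (cg : {within L, continuous g}).
Hypotheses (Lgam : forall u, 0 <= u <= 1 -> L (gam u)).
Hypotheses (g01 : forall x, L x -> 0 <= g x <= 1).
Hypotheses (gK : forall u, 0 <= u <= 1 -> g (gam u) = u).
Hypotheses (gamK : forall x, L x -> gam (g x) = x).
Implicit Types (T S V : 'rV[R]_N -> 'rV[R]_N) (u v z : R).

(** Uniform continuity of the inverse parametrization on the compact arc; the modulus is the
    parameter in the near-covering form of compactness. *)
Lemma arc_unif (eta : R) : 0 < eta -> exists2 d, 0 < d &
  forall x y, L x -> L y -> enorm (x - y) < d -> `|g x - g y| < eta.
Proof.
move=> eta0.
pose P (d : R) (x : 'rV[R]_N) := L x -> forall y, L y -> `|x - y| < d -> `|g x - g y| < eta.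
have := (proj1 (compact_near_coveringP L) cL) R (0^'+) P _.
case=> [x0 Lx|d /= d0 dP].
  pose x : 'rV[R]_N := x0; rewrite -/x in Lx *.
  have e2 : 0 < eta / 2 by lra.
  have [d d0 dP] := (proj1 (within_continuous_epsP L g) cg) x Lx _ e2.
  have d20 : 0 < d / 2 by lra.
  exists ([set x' | `|x - x'| < d / 2], [set d' | d' < d / 2]) => /=.
    split.
      by apply: (proj2 (nbhs_normP x (fun x' => `|x - x'| < d / 2))); exists (d / 2).
    exact: nbhs_right_lt.
  move=> [x' d'] [/= xx' d'd] Lx' y Ly x'y.
  have h1 : `|g x - g x'| < eta / 2 by apply: dP => //; lra.
  have h2 : `|g x - g y| < eta / 2.
    apply: dP => //; have -> : x - y = (x - x') + (x' - y) by rewrite subrKA.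
    apply: le_lt_trans (ler_normD _ _) _; lra.
  have -> : g x' - g y = (g x - g y) - (g x - g x') by ring.
  apply: le_lt_trans (ler_normB _ _) _; lra.
have d20 : 0 < d / 2 by lra.
exists (d / 2) => // x y Lx Ly xy.
have := dP (d / 2); rewrite /ball_ /= => /(_ _ d20 x Lx Lx y Ly); apply.
  by rewrite sub0r normrN gtr0_norm//; lra.
exact: le_lt_trans (norm_le_enorm _) xy.
Qed.

Definition emb (rho : R) T : Prop := similitude rho T /\ T @` L `<=` L.

Lemma emb_comp a b T S : emb a T -> emb b S -> emb (a * b) (T \o S).
Proof.
move=> [sT TL] [sS SL]; split; first exact: similitude_comp.
by move=> _ [x Lx <-]; apply: TL; exists (S x) => //; apply: SL; exists x.
Qed.

(* The map induced by [T] on the parameter interval. *)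
Definition cj T u : R := g (T (gam u)).
(** [T] may reverse the orientation of the arc, hence a minimum here and a maximum in [hi]. *)
Definition lo T : R := Num.min (cj T 0) (cj T 1).
Definition hi T : R := Num.max (cj T 0) (cj T 1).

Lemma emb_gam rho T u : emb rho T -> 0 <= u <= 1 -> L (T (gam u)).
Proof. by move=> [_ TL] u01; apply: TL; exists (gam u) => //; exact: Lgam. Qed.

Lemma gam_cj rho T u : emb rho T -> 0 <= u <= 1 -> gam (cj T u) = T (gam u).
Proof. by move=> eT u01; apply: gamK; exact: emb_gam eT u01. Qed.

Lemma cj01 rho T u : emb rho T -> 0 <= u <= 1 -> 0 <= cj T u <= 1.
Proof. by move=> eT u01; apply: g01; exact: emb_gam eT u01. Qed.

Lemma cj_comp b T S u : emb b S -> 0 <= u <= 1 -> cj (T \o S) u = cj T (cj S u).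
Proof. by move=> eS u01; rewrite {2}/cj (gam_cj eS u01). Qed.

Lemma enorm_cj rho T u v : emb rho T -> 0 <= u <= 1 -> 0 <= v <= 1 ->
  enorm (gam (cj T u) - gam (cj T v)) = rho * enorm (gam u - gam v).
Proof. by move=> eT u01 v01; rewrite !(gam_cj eT)// eT.1.2. Qed.

Lemma cj_inj rho T : emb rho T -> {in `[0, 1]%R &, injective (cj T)}.
Proof.
move=> eT u v; rewrite !in_itv /= => u01 v01 E.
rewrite -(gK u01) -(gK v01); congr g; apply: (similitude_inj eT.1).
by rewrite -!(gam_cj eT)// E.
Qed.

Lemma cj_continuous rho T : emb rho T -> {within `[0, 1]%classic, continuous (cj T)}.
Proof.
move=> eT; have [[rho0 TP] TL] := eT.
apply/within_continuous_epsP => u /= u01 e e0.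
rewrite in_itv/= in u01.
have [d d0 dP] := (proj1 (within_continuous_epsP L g) cg) _ (emb_gam eT u01) _ e0.
have N0 : 0 < N.+1%:R :> R by [].
have d'0 : 0 < d / (rho * N.+1%:R) by rewrite divr_gt0// mulr_gt0.
have u01' : `[0, 1]%classic u by rewrite /= in_itv.
have [d2 d20 d2P] := (proj1 (within_continuous_epsP _ _) cgam) u u01' _ d'0.
exists d2 => // v /= v01 uv; rewrite in_itv/= in v01.
apply: dP; first exact: emb_gam eT v01.
apply: le_lt_trans (norm_le_enorm _) _; rewrite TP.
have /d2P/(_ uv) : `[0, 1]%classic v by rewrite /= in_itv.
rewrite ltr_pdivlMr ?mulr_gt0// => H; apply: le_lt_trans H.
by rewrite mulrCA ler_pM2l// mulrC enorm_le_norm.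
Qed.

(** A continuous injective function on an interval is strictly monotone; the two cases are the two
    orientations. *)
Lemma cj_mono rho T : emb rho T ->
  (lo T = cj T 0 /\ hi T = cj T 1 /\
    forall u v, 0 <= u <= 1 -> 0 <= v <= 1 -> (cj T u < cj T v) = (u < v)) \/
  (lo T = cj T 1 /\ hi T = cj T 0 /\
    forall u v, 0 <= u <= 1 -> 0 <= v <= 1 -> (cj T u < cj T v) = (v < u)).
Proof.
move=> eT.
have [inc|dec] := itv_continuous_inj_mono (cj_continuous eT) (cj_inj eT); [left|right].
  have H u v : 0 <= u <= 1 -> 0 <= v <= 1 -> (cj T u < cj T v) = (u < v).
    by move=> u01 v01; apply: (leW_mono_in (le_mono_in inc)); rewrite in_itv.
  have c01 : cj T 0 < cj T 1 by rewrite H ?ltr01// ?lexx ?ler01.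
  by rewrite /lo /hi (min_idPl (ltW c01)) (max_idPr (ltW c01)).
have H u v : 0 <= u <= 1 -> 0 <= v <= 1 -> (cj T u < cj T v) = (v < u).
  by move=> u01 v01; apply: (leW_nmono_in (le_nmono_in dec)); rewrite in_itv.
have c01 : cj T 1 < cj T 0 by rewrite H ?ltr01// ?lexx ?ler01.
by rewrite /lo /hi (min_idPr (ltW c01)) (max_idPl (ltW c01)).
Qed.

Let i0 : 0 <= (0 : R) <= 1. Proof. by rewrite lexx ler01. Qed.
Let i1 : 0 <= (1 : R) <= 1. Proof. by rewrite lexx ler01. Qed.

Lemma lo_hi rho T : emb rho T -> [/\ 0 <= lo T, lo T < hi T & hi T <= 1].
Proof.
move=> eT; have /andP[a0 a1] := cj01 eT i0; have /andP[b0 b1] := cj01 eT i1.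
by have [[-> [-> H]]|[-> [-> H]]] := cj_mono eT; split=> //; rewrite H.
Qed.

Lemma cj_interior rho T u : emb rho T -> 0 < u < 1 -> lo T < cj T u < hi T.
Proof.
move=> eT /andP[u0 u1]; have u01 : 0 <= u <= 1 by rewrite !ltW.
by have [[-> [-> H]]|[-> [-> H]]] := cj_mono eT; rewrite !H// u0 u1.
Qed.

Lemma cj_in rho T u : emb rho T -> 0 <= u <= 1 -> lo T <= cj T u <= hi T.
Proof.
move=> eT u01; have /andP[u0 u1] := u01.
by have [[-> [-> H]]|[-> [-> H]]] := cj_mono eT; rewrite !leNgt !H// -!leNgt u0 u1.
Qed.

Lemma cj_onto rho T z : emb rho T -> lo T <= z <= hi T ->
  exists2 u, 0 <= u <= 1 & cj T u = z.
Proof.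
move=> eT zT; have [u] := IVT ler01 (cj_continuous eT) zT.
by rewrite in_itv /= => u01 <-; exists u.
Qed.

(** Turns questions about pieces of the arc into inequalities between parameters. *)
Lemma img_interval rho T z : emb rho T -> 0 <= z <= 1 ->
  (T @` L) (gam z) <-> lo T <= z <= hi T.
Proof.
move=> eT z01; split=> [[x Lx Tx]|/(cj_onto eT)[u u01 <-]].
  have -> : z = cj T (g x) by rewrite -(gK z01) -Tx /cj gamK.
  exact: cj_in eT (g01 Lx).
by exists (gam u); [exact: Lgam|rewrite (gam_cj eT)].
Qed.

Lemma disjoint_intervals a b T S : emb a T -> emb b S ->
  (forall x, (T @` L) x -> (S @` L) x -> False) -> hi T < lo S \/ hi S < lo T.
Proof.
move=> eT eS dis.
have [Tl Th T1] := lo_hi eT; have [Sl Sh S1] := lo_hi eS.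
have [h1|h1] := ltP (hi T) (lo S); first by left.
have [h2|h2] := ltP (hi S) (lo T); first by right.
exfalso; pose z := Num.max (lo T) (lo S).
have z01 : 0 <= z <= 1 
  by rewrite /z le_max Tl /= ge_max !(le_trans (ltW Th) T1, le_trans (ltW Sh) S1).
apply: (dis (gam z)); first by apply/(img_interval eT z01); rewrite /z le_max lexx /= ge_max h1 ltW.
by apply/(img_interval eS z01); rewrite /z le_max lexx orbT /= ge_max h2 ltW.
Qed.

(* Two subarcs with at most one common point can only meet at end points. *)
Lemma interior_disjoint a b T S u : emb a T -> emb b S ->
  at_most_one (T @` L) (S @` L) -> 0 < u < 1 -> ~ (S @` L) (T (gam u)).
Proof.
move=> eT eS amo u01 Su; have /andP[c1 c2] := cj_interior eT u01.
have u01' : 0 <= u <= 1 by have /andP[? ?] := u01; rewrite !ltW.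
have z01 := cj01 eT u01'; set z := cj T u in c1 c2 z01.
have [Tl Th T1] := lo_hi eT; have [Sl Sh S1] := lo_hi eS.
have Sz : (S @` L) (gam z) by rewrite (gam_cj eT).
have Tz : (T @` L) (gam z) by apply/(img_interval eT z01); rewrite !ltW.
have /andP[d1 d2] := proj1 (img_interval eS z01) Sz.
have key z' : 0 <= z' <= 1 -> lo T <= z' <= hi T -> lo S <= z' <= hi S -> z' = z.
  move=> z'01 Tz' Sz'; rewrite -(gK z'01) -(gK z01); congr g; apply: amo => //.
    exact/(img_interval eT z'01).
  exact/(img_interval eS z'01).
have /andP[z0 z1] := z01.
(* As [z] is interior to the interval of [T], a second common parameter exists: to the right of [z]
   if [z < hi S], to the left otherwise. *)
have [h|h] := ltP z (hi S).
  pose z' := Num.min (hi T) (hi S).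
  have zz' : z < z' by rewrite /z' lt_min c2 h.
  suff E : z' = z by rewrite E ltxx in zz'.
  have z'T : z' <= hi T by rewrite /z' ge_min lexx.
  have z'S : z' <= hi S by rewrite /z' ge_min lexx orbT.
  have zz := ltW zz'.
  apply: key; apply/andP; split=> //.
  - exact: le_trans zz.
  - exact: le_trans T1.
  - exact: le_trans (ltW c1) zz.
  - exact: le_trans d1 zz.
pose y' := Num.max (lo T) (lo S).
have yz : y' < z by rewrite /y' gt_max c1 (lt_le_trans Sh).
suff E : y' = z by rewrite E ltxx in yz.
have y'T : lo T <= y' by rewrite /y' le_max lexx.
have y'S : lo S <= y' by rewrite /y' le_max lexx orbT.
apply: key; apply/andP; split=> //.
- exact: le_trans y'T.
- exact: le_trans (ltW yz) z1.
- exact: ltW (lt_trans yz c2).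
- exact: le_trans (ltW yz) d2.
Qed.

(** No mass carried by [[a, b]] lies between [u] and [v]. *)
Definition misses u v (a b : R) : Prop := (u < a /\ v < a) \/ (b < u /\ b < v).

Lemma misses_cj a b V S u v : emb a V -> emb b S -> 0 <= u <= 1 -> 0 <= v <= 1 ->
  misses u v (lo S) (hi S) -> misses (cj V u) (cj V v) (lo (V \o S)) (hi (V \o S)).
Proof.
move=> eV eS u01 v01 m.
have s0 := cj01 eS i0; have s1 := cj01 eS i1.
rewrite /misses /lo /hi !(cj_comp _ eS i0) !(cj_comp _ eS i1) !lt_min !gt_max.
have {m} : (u < cj S 0 /\ u < cj S 1) /\ (v < cj S 0 /\ v < cj S 1) \/
    (cj S 0 < u /\ cj S 1 < u) /\ (cj S 0 < v /\ cj S 1 < v).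
  case: m; rewrite /lo /hi ?lt_min ?gt_max => -[/andP[? ?] /andP[? ?]]; [left|right]; by split.
have [[_ [_ H]]|[_ [_ H]]] := cj_mono eV; rewrite !H//;
move=> -[[[-> ->] [-> ->]]|[[-> ->] [-> ->]]]; by [left|right].
Qed.

Lemma cj_comp_interior a b T S : emb a T -> emb b S -> 0 < lo S -> hi S < 1 ->
  lo T < lo (T \o S) /\ hi (T \o S) < hi T.
Proof.
move=> eT eS l0 h1.
have s0 := cj_in eS i0; have s1 := cj_in eS i1.
have in01 z : lo S <= z <= hi S -> 0 < z < 1.
  by move=> /andP[z1 z2]; rewrite (lt_le_trans l0)//= (le_lt_trans z2).
have /andP[a1 a2] := cj_interior eT (in01 _ s0).
have /andP[b1 b2] := cj_interior eT (in01 _ s1).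
by rewrite {2}/lo {1}/hi !(cj_comp _ eS)// lt_min gt_max a1 a2 b1 b2.
Qed.

(** * Distribution function of the Cantor measure of a disjoint subsystem *)

Section subsystem.
Variables (J : finType) (T : J -> 'rV[R]_N -> 'rV[R]_N) (rho p : J -> R) (t q : R).
Hypotheses (eT : forall j, emb (rho j) (T j)).
Hypothesis disjT : forall i j, i != j -> hi (T i) < lo (T j) \/ hi (T j) < lo (T i).
Hypotheses (loT : forall j, 0 < lo (T j)) (hiT : forall j, hi (T j) < 1).
Hypotheses (t0 : 0 < t) (p0 : forall j, 0 <= p j) (prho : forall j, p j <= rho j `^ t).
Hypotheses (sump : \sum_j p j = 1) (q01 : 0 <= q < 1) (pq : forall j, p j <= q).

(* Mass of the level [k] cylinders of [V @` L] contained in [gam @` `[0, u]]. *)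
Fixpoint mass (k : nat) V u : R :=
  if k is k'.+1 then \sum_j p j * mass k' (V \o T j) u
  else if hi V <= u then 1 else 0.

Lemma mass01 k V u : 0 <= mass k V u <= 1.
Proof.
elim: k V => [|k IH] V /=; first by case: ifP; rewrite ?lexx ler01.
apply/andP; split.
  by apply: sumr_ge0 => j _; rewrite mulr_ge0//; case/andP: (IH (V \o T j)).
rewrite -sump; apply: ler_sum => j _; rewrite -[leRHS]mulr1 ler_wpM2l//.
by case/andP: (IH (V \o T j)).
Qed.

Lemma mass_dist k V u v : `|mass k V u - mass k V v| <= 1.
Proof.
have /andP[? ?] := mass01 k V u; have /andP[? ?] := mass01 k V v.
by rewrite ler_norml; apply/andP; split; lra.
Qed.

Lemma mass_mono k V u v : u <= v -> mass k V u <= mass k V v.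
Proof.
move=> uv; elim: k V => [|k IH] V /=.
  case: ifP => // Vu; first by rewrite (le_trans Vu).
  by case: ifP.
by apply: ler_sum => j _; rewrite ler_wpM2l.
Qed.

Lemma emb_compT a V j : emb a V -> lo V < lo (V \o T j) /\ hi (V \o T j) < hi V.
Proof. by move=> eV; exact: cj_comp_interior eV (eT j) (loT j) (hiT j). Qed.

Lemma mass_low k a V u : emb a V -> u < lo V -> mass k V u = 0.
Proof.
elim: k a V => [|k IH] a V eV uV /=.
  by have [_ h _] := lo_hi eV; rewrite leNgt (lt_trans uV).
apply: big1 => j _; rewrite (IH _ _ (emb_comp eV (eT j))) ?mulr0//.
by apply: lt_trans uV _; exact: (emb_compT j eV).1.
Qed.

Lemma mass_high k a V u : emb a V -> hi V <= u -> mass k V u = 1.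
Proof.
elim: k a V => [|k IH] a V eV uV /=; first by rewrite uV.
rewrite -sump; apply: eq_bigr => j _; rewrite (IH _ _ (emb_comp eV (eT j))) ?mulr1//.
by apply: le_trans uV; apply: ltW; exact: (emb_compT j eV).2.
Qed.

(** A cylinder lying to the left of [u] has all its children there, and their weights add up to its
    own. *)
Lemma mass_incr k a V u : emb a V -> mass k V u <= mass k.+1 V u.
Proof.
elim: k a V => [|k IH] a V eV.
  rewrite {1}/mass; case: ifP => Vu; first by rewrite (mass_high _ eV).
  by case/andP: (mass01 1 V u).
rewrite /=; apply: ler_sum => j _; rewrite ler_wpM2l//.
exact: IH (emb_comp eV (eT j)).
Qed.

Lemma mass_misses k a V u v : emb a V -> misses u v (lo V) (hi V) ->
  mass k V u = mass k V v.
Proof.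
move=> eV [[h1 h2]|[h1 h2]]; first by rewrite !(mass_low _ eV).
by rewrite !(mass_high _ eV)// ltW.
Qed.

(** Every child interval keeps a margin [eta] inside that of [V]. Parameters closer than [eta] that
    touch or enclose a child interval must therefore both lie in the interval of [V]. *)
Lemma arc_gap a V : emb a V -> exists2 d, 0 < d & forall u v, 0 <= u <= 1 -> 0 <= v <= 1 ->
  enorm (gam u - gam v) < d ->
  (lo V <= u <= hi V /\ lo V <= v <= hi V) \/
  forall j, misses u v (lo (V \o T j)) (hi (V \o T j)).
Proof.
move=> eV.
have [|eta eta0 etaP'] := @finite_positive_lower_bound R J
    (fun j => Num.min (lo (V \o T j) - lo V) (hi V - hi (V \o T j))).
  by move=> j; rewrite lt_min !subr_gt0; have [-> ->] := emb_compT j eV.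
have etaP j : eta <= lo (V \o T j) - lo V /\ eta <= hi V - hi (V \o T j).
  by have := etaP' j; rewrite le_min => /andP[].
have [d d0 dP] := arc_unif eta0; exists d => // u v u01 v01 uv.
have := dP _ _ (Lgam u01) (Lgam v01) uv; rewrite !gK// ltr_distl => /andP[h1 h2].
have [H|H] := pselect (lo V <= u <= hi V /\ lo V <= v <= hi V); [by left|right => j].
have [e1 e2] := etaP j.
have [a1|a1] := ltP u (lo (V \o T j)).
  have [a2|a2] := ltP v (lo (V \o T j)); first by left.
  have [a3|a3] := ltP (hi (V \o T j)) v; last by exfalso; apply: H; split; apply/andP; split; lra.
  by exfalso; apply: H; split; apply/andP; split; have [_ hh _] := lo_hi (emb_comp eV (eT j)); lra.
have [a2|a2] := ltP (hi (V \o T j)) u.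
  have [a3|a3] := ltP (hi (V \o T j)) v; first by right.
  exfalso; apply: H; have [_ hh _] := lo_hi (emb_comp eV (eT j)); split; apply/andP; split; lra.
exfalso; apply: H; split; apply/andP; split; lra.
Qed.

(* The constant does not depend on [V]: either [gam u] and [gam v] are at distance
   at least [d], or they lie in the same [T j @` L], in which case both sides
   rescale, or no mass of level two lies between them. *)
Lemma mass_hoelder_uniform : exists2 d, 0 < d & forall k a V u v, emb a V ->
  0 <= u <= 1 -> 0 <= v <= 1 ->
  `|mass k V (cj V u) - mass k V (cj V v)| <= (enorm (gam u - gam v) / d) `^ t + q ^+ k.-1.
Proof.
have /choice[dj djP] : forall j, exists d, 0 < d /\ forall u v, 0 <= u <= 1 -> 0 <= v <= 1 ->
    enorm (gam u - gam v) < d ->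
    (lo (T j) <= u <= hi (T j) /\ lo (T j) <= v <= hi (T j)) \/
    forall j', misses u v (lo (T j \o T j')) (hi (T j \o T j')).
  by move=> j; have [d d0 dP] := arc_gap (eT j); exists d.
have [|d d0 dP] := @finite_positive_lower_bound R J dj; first by move=> j; exact: (djP j).1.
have [q0 q1] := andP q01.
exists d => // k; elim: k => [|k IH] a V u v eV u01 v01.
  by apply: le_trans (mass_dist _ _ _ _) _; rewrite expr0 lerDr powR_ge0.
(* Levels 0 and 1 both use the trivial bound 1, whence the exponent [k.-1]: the gap argument looks
   two levels down. *)
case: k IH => [|k] IH.
  by apply: le_trans (mass_dist _ _ _ _) _; rewrite expr0 lerDr powR_ge0.
have e0 : 0 <= enorm (gam u - gam v) / d by rewrite divr_ge0 ?enorm_ge0 ?ltW.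
have [far|near] := leP d (enorm (gam u - gam v)).
  apply: le_trans (mass_dist _ _ _ _) _; apply: le_trans (_ : (1 : R) `^ t <= _).
    by rewrite powR1.
  apply: le_trans (_ : (enorm (gam u - gam v) / d) `^ t <= _); last first.
    by rewrite lerDl exprn_ge0.
  by apply: ge0_ler_powR; rewrite ?nnegrE ?(ltW t0)// ler_pdivlMr// mul1r.
have [[j [uj vj]]|none] := pselect (exists j,
    lo (T j) <= u <= hi (T j) /\ lo (T j) <= v <= hi (T j)); last first.
  have m j j' : misses u v (lo (T j \o T j')) (hi (T j \o T j')).
    have [H|] := (djP j).2 u v u01 v01 (lt_le_trans near (dP j)); last exact.
    by exfalso; apply: none; exists j.
  suff -> : mass k.+2 V (cj V u) = mass k.+2 V (cj V v).
    by rewrite subrr normr0 addr_ge0 ?powR_ge0 ?exprn_ge0.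
  rewrite /=; apply: eq_bigr => j _; congr (_ * _); apply: eq_bigr => j' _; congr (_ * _).
  have eTT := emb_comp (eT j) (eT j').
  by apply: (mass_misses _ (emb_comp eV eTT)); exact: misses_cj eV eTT u01 v01 (m j j').
have [u' u'01 uE] := cj_onto (eT j) uj; have [v' v'01 vE] := cj_onto (eT j) vj.
have eVT := emb_comp eV (eT j).
(* Both points lie in piece [j], so every other piece, being disjoint from it, has them on the same
   side. *)
have -> : mass k.+2 V (cj V u) - mass k.+2 V (cj V v) =
  p j * (mass k.+1 (V \o T j) (cj (V \o T j) u') - mass k.+1 (V \o T j) (cj (V \o T j) v')).
  rewrite !(cj_comp _ (eT j))// uE vE.
  change (\sum_i p i * mass k.+1 (V \o T i) (cj V u) - \sum_i p i * mass k.+1 (V \o T i) (cj V v) =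
    p j * (mass k.+1 (V \o T j) (cj V u) - mass k.+1 (V \o T j) (cj V v))).
  rewrite -sumrB (bigD1 j)// [\sum_(i | i != j) _]big1 => [|i ij].
    by rewrite [LHS]addr0 mulrBr.
  suff -> : mass k.+1 (V \o T i) (cj V u) = mass k.+1 (V \o T i) (cj V v) by rewrite subrr.
  apply: (mass_misses _ (emb_comp eV (eT i))); apply: (misses_cj eV (eT i)) => //.
  have /andP[u1 u2] := uj; have /andP[v1 v2] := vj.
  by have [h|h] := disjT ij; [right|left]; split;
     rewrite ?(lt_le_trans h)// (le_lt_trans _ h).
rewrite normrM (ger0_norm (p0 j)).
(* The factor [p j] is used twice: [prho] absorbs the rescaled distance, and [pq] improves the error
   by one power of [q]. *)
apply: le_trans (ler_wpM2l (p0 j) (IH _ _ u' v' eVT u'01 v'01)) _.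
rewrite mulrDr lerD//; last by rewrite /= exprS ler_wpM2r// exprn_ge0.
have rho0 : 0 <= rho j := ltW (eT j).1.1.
have -> : enorm (gam u - gam v) / d = rho j * (enorm (gam u' - gam v') / d).
  by rewrite -uE -vE (enorm_cj (eT j))// mulrA.
rewrite [leRHS]powRM//; last by rewrite divr_ge0 ?enorm_ge0 ?ltW.
by apply: ler_wpM2r => //; exact: powR_ge0.
Qed.

(** The uniform estimate concerns points of the image of [V], here rescaled by [a]. Close points not
    both in it have no child of [V] between them, and distant ones are handled by the bound 1. *)
Lemma mass_hoelder a V : emb a V -> exists2 M, 0 < M & forall k u v,
  0 <= u <= 1 -> 0 <= v <= 1 ->
  `|mass k V u - mass k V v| <= M * enorm (gam u - gam v) `^ t + q ^+ k.-1.
Proof.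
move=> eV; have [d d0 dP] := mass_hoelder_uniform; have [d' d'0 d'P] := arc_gap eV.
have a0 : 0 < a := eV.1.1.
have [q0 q1] := andP q01.
have m0 : 0 < (a * d)^-1 `^ t by rewrite powR_gt0// invr_gt0 mulr_gt0.
have m'0 : 0 < d'^-1 `^ t by rewrite powR_gt0// invr_gt0.
exists ((a * d)^-1 `^ t + d'^-1 `^ t) => [|k u v u01 v01]; first exact: addr_gt0.
have E c : 0 < c -> c^-1 `^ t * enorm (gam u - gam v) `^ t = (enorm (gam u - gam v) / c) `^ t.
  by move=> c0; rewrite mulrC -powRM ?enorm_ge0// invr_ge0 ltW.
have le1 x : x <= (enorm (gam u - gam v) / (a * d)) `^ t + q ^+ k.-1 ->
    x <= ((a * d)^-1 `^ t + d'^-1 `^ t) * enorm (gam u - gam v) `^ t + q ^+ k.-1.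
  move=> /le_trans; apply; rewrite lerD2r mulrDl !E ?mulr_gt0// lerDl powR_ge0//.
have [far|near] := leP d' (enorm (gam u - gam v)).
  apply: le_trans (mass_dist _ _ _ _) _; rewrite mulrDl !E ?mulr_gt0//.
  apply: le_trans (_ : (enorm (gam u - gam v) / d') `^ t <= _); last first.
    by rewrite -addrA addrCA lerDl addr_ge0 ?powR_ge0 ?exprn_ge0.
  apply: le_trans (_ : (1 : R) `^ t <= _); first by rewrite powR1.
  apply: ge0_ler_powR; rewrite ?nnegrE ?(ltW t0)//.
    by rewrite divr_ge0 ?enorm_ge0 ?ltW.
  by rewrite ler_pdivlMr// mul1r.
apply: le1.
have [[uV vV]|none] := d'P u v u01 v01 near.
  have [u' u'01 uE] := cj_onto eV uV; have [v' v'01 vE] := cj_onto eV vV.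
  apply: le_trans (_ : (enorm (gam u' - gam v') / d) `^ t + q ^+ k.-1 <= _).
    by rewrite -uE -vE; exact: dP eV u'01 v'01.
  rewrite lerD2r -uE -vE (enorm_cj eV)// -mulf_div divff ?mul1r//.
  by rewrite gt_eqF.
case: k => [|k].
  by apply: le_trans (mass_dist _ _ _ _) _; rewrite expr0 lerDr powR_ge0.
suff -> : mass k.+1 V u = mass k.+1 V v.
  by rewrite subrr normr0 addr_ge0 ?powR_ge0 ?exprn_ge0.
rewrite /=; apply: eq_bigr => j _; congr (_ * _).
exact: (mass_misses _ (emb_comp eV (eT j)) (none j)).
Qed.

(** [F] is the increasing limit of [mass k V]; the error [q ^+ k.-1] disappears in the limit. *)
Lemma subsystem_hoelder_function a V : emb a V -> exists (F : R -> R) (M : R),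
  [/\ 0 < M, forall u v, u <= v -> F u <= F v,
      forall u, u < lo V -> F u = 0, forall u, hi V <= u -> F u = 1 &
      forall u v, 0 <= u <= 1 -> 0 <= v <= 1 ->
        `|F u - F v| <= M * enorm (gam u - gam v) `^ t].
Proof.
move=> eV; have [M M0 MP] := mass_hoelder eV.
have c u : (fun k => mass k V u) @ \oo --> limn (fun k => mass k V u).
  apply: nondecreasing_is_cvgn.
    by apply/nondecreasing_seqP => k; exact: mass_incr eV.
  by exists 1 => _ [k _ <-]; case/andP: (mass01 k V u).
exists (fun u => limn (fun k => mass k V u)), M; split=> //.
- move=> u v uv; apply: ler_lim => //.
  by apply: nearW => k; exact: mass_mono.
- move=> u uV; rewrite (_ : (fun k => mass k V u) = cst 0) ?lim_cst//.
  by apply/funext => k; rewrite (mass_low _ eV).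
- move=> u uV; rewrite (_ : (fun k => mass k V u) = cst 1) ?lim_cst//.
  by apply/funext => k; rewrite (mass_high _ eV).
- move=> u v u01 v01; set e := M * _.
  have cq : q ^+ k.-1 @[k --> \oo] --> 0.
    have : q ^+ k @[k --> \oo] --> 0 by apply: cvg_expr; case/andP: q01 => ? ?; rewrite ger0_norm.
    by rewrite -[in X in _ -> X](cvg_shiftS (fun k => q ^+ k.-1)).
  have l1 : `|mass k V u - mass k V v| @[k --> \oo] -->
    `|limn (fun k => mass k V u) - limn (fun k => mass k V v)|.
    by apply: cvg_norm; apply: cvgB; exact: c.
  have l2 : e + q ^+ k.-1 @[k --> \oo] --> e + 0 by apply: cvgD => //; exact: cvg_cst.
  rewrite addr0 in l2; rewrite -(cvg_lim _ l1)// -(cvg_lim _ l2)//.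
  apply: ler_lim; [apply/cvg_ex; eexists; exact: l1|apply/cvg_ex; eexists; exact: l2|].
  by apply: nearW => k; exact: MP.
Qed.

End subsystem.

(** * Hoelder functions increasing along the whole arc *)

Section self_similar_arc_function.
Variables (l : nat) (S : 'I_l -> 'rV[R]_N -> 'rV[R]_N) (r : 'I_l -> R) (rm D t : R).
Hypotheses (hS : forall i, similitude (r i) (S i)) (rmP : forall i, r i <= rm).
Hypothesis rm01 : 0 <= rm < 1.
Hypotheses (LD : forall x y, L x -> L y -> enorm (x - y) <= D).
Hypotheses (LE : L = \bigcup_(i : 'I_l) (S i @` L)).
Hypotheses (amo : forall i j, i != j -> at_most_one (S i @` L) (S j @` L)).
Hypotheses (t0 : 0 < t) (sum1 : 1 < \sum_i r i `^ t).

(** A piece of high level through the midpoint parameter has small diameter, hence a short parameter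
    interval. The level is positive so that the ratio is below 1. *)
Lemma small_emb a b : 0 <= a -> a < b -> b <= 1 -> exists rho V,
  [/\ emb rho V, rho < 1, a < lo V & hi V < b].
Proof.
move=> a0 ab b1; have [rm0 rm1] := andP rm01.
pose c := (a + b) / 2; have c01 : 0 <= c <= 1 by rewrite /c; apply/andP; split; lra.
have eta0 : 0 < (b - a) / 2 by lra.
have [d d0 dP] := arc_unif eta0.
have [n] : exists n, rm ^+ n.+1 * D < d.
  have : geometric D rm @ \oo --> 0 by apply: cvg_geometric; rewrite ger0_norm.
  move/cvgrPdist_lt => /(_ d d0)[n _ /(_ n.+1 (leqnSn n))] /=.
  rewrite sub0r normrN => H; exists n; apply: le_lt_trans H.
  by rewrite mulrC ler_norm.
move=> nP; have [J [T [rho [sT TL LT _ _]]]] := iterated_system hS rmP LE amo n.+1.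
have [j _ Tc] := LT _ (Lgam c01).
have eT : emb (rho j) (T j) by split; [exact: (sT j).1|exact: TL].
have [l0 lh h1] := lo_hi eT.
have close z : 0 <= z <= 1 -> lo (T j) <= z <= hi (T j) -> a < z < b.
  move=> z01 /(img_interval eT z01) Tz.
  have : `|z - c| < (b - a) / 2.
    rewrite -{1}(gK z01) -{1}(gK c01); apply: dP; try exact: Lgam.
    case: Tz => x Lx <-; case: Tc => y Ly <-; rewrite (sT j).1.2.
    apply: le_lt_trans nP; apply: ler_pM; rewrite ?enorm_ge0//.
    - exact: ltW (sT j).1.1.
    - exact: (sT j).2.
    - exact: LD.
  by rewrite ltr_distl /c => /andP[? ?]; apply/andP; split; lra.
exists (rho j), (T j); split => //.
- apply: le_lt_trans (sT j).2 _; rewrite exprS; apply: le_lt_trans rm1.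
  rewrite -[leRHS]mulr1; apply: ler_wpM2l => //.
  by case/andP: rm01 => h2 h3; apply: exprn_ile1 => //; exact: ltW.
- suff /andP[] : a < lo (T j) < b by [].
  by apply: close; rewrite ?lexx ?l0 ?(ltW lh)// (le_trans (ltW lh)).
- suff /andP[] : a < hi (T j) < b by [].
  by apply: close; rewrite ?lexx ?h1 ?(ltW lh)// (le_trans l0 (ltW lh)).
Qed.

(* The subsystem of maps [T_w \o Vm], with [Vm @` L] away from the end points of
   the arc, has disjoint images, and [w] long makes its similarity dimension
   larger than [t]. *)
Lemma step_function a b : 0 <= a -> a < b -> b <= 1 -> exists (F : R -> R) (M : R),
  [/\ 0 < M, forall u v, u <= v -> F u <= F v, forall u, 0 <= F u <= 1, F a < F b &
      forall u v, 0 <= u <= 1 -> 0 <= v <= 1 ->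
        `|F u - F v| <= M * enorm (gam u - gam v) `^ t].
Proof.
move=> a0 ab b1.
(* [V] confines the increase of [F] to parameters strictly between [a] and [b]. *)
have [rhoV [V [eV _ aV Vb]]] := small_emb a0 ab b1.
have [rhom [Vm [em rhom1 m0 m1]]] := small_emb (lexx 0) ltr01 (lexx 1).
have rhom0 : 0 < rhom := em.1.1.
pose s := \sum_i r i `^ t; have s1 : 1 < s := sum1.
have c0 : 0 < rhom `^ t by rewrite powR_gt0.
have [n nP] : exists n, 1 <= s ^+ n * rhom `^ t.
  have s0 : 0 < s by exact: lt_trans s1.
  have : geometric 1 s^-1 @ \oo --> 0.
    by apply: cvg_geometric; rewrite ger0_norm ?invr_ge0 ?(ltW s0)// invf_lt1.
  move/cvgrPdist_le => /(_ _ c0)[n _ /(_ n (leqnn n))] /=.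
  rewrite sub0r normrN mul1r => H; exists n; rewrite mulrC -ler_pdivrMr ?exprn_gt0//.
  by rewrite div1r -exprVn; apply: le_trans H; exact: ler_norm.
have [J [T [rho [sT TL LT sumT amoT]]]] := iterated_system hS rmP LE amo n.
have eT j : emb (rho j) (T j) by split; [exact: (sT j).1|exact: TL].
have rho0 j : 0 < rho j := (sT j).1.1.
pose Z := s ^+ n * rhom `^ t.
have Z0 : 0 < Z by exact: lt_le_trans nP.
(* [Z] is the sum of the numerators, so the weights sum to 1; [1 <= Z] keeps each weight below its
   numerator. *)
pose p j := (rho j * rhom) `^ t / Z.
have ple j : p j <= (rho j * rhom) `^ t by rewrite /p ler_pdivrMr// ler_peMr// powR_ge0.
have rho1 j : rho j <= 1.
  by apply: le_trans (sT j).2 _; apply: exprn_ile1; case/andP: rm01 => // _ /ltW.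
have mint u : lo Vm <= u <= hi Vm -> 0 < u < 1.
  by move=> /andP[h1 h2]; rewrite (lt_le_trans m0 h1) (le_lt_trans h2).
have [||||||||||F [M [M0 Fm Fl Fh FH]]] := @subsystem_hoelder_function J (fun j => T j \o Vm)
    (fun j => rho j * rhom) p t (rhom `^ t) _ _ _ _ _ _ _ _ _ _ rhoV V eV.
- by move=> j; exact: emb_comp (eT j) em.
- move=> i j ij; apply: (disjoint_intervals (emb_comp (eT i) em) (emb_comp (eT j) em)).
  move=> x [y Ly <-] [z Lz /= E].
  have eq1 : gam (g (Vm y)) = Vm y by apply: gamK; apply: em.2; exists y.
  have u01 : 0 < g (Vm y) < 1.
    apply: mint; apply/(img_interval em); first by apply: g01; apply: em.2; exists y.
    by rewrite eq1; exists y.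
  apply: (interior_disjoint (eT i) (eT j) (amoT _ _ ij) u01).
  by rewrite eq1 /= -E; exists (Vm z) => //; apply: em.2; exists z.
- move=> j; have [h1 h2] := cj_comp_interior (eT j) em m0 m1; have [h3 _ _] := lo_hi (eT j).
  exact: le_lt_trans h1.
- move=> j; have [h1 h2] := cj_comp_interior (eT j) em m0 m1; have [_ _ h3] := lo_hi (eT j).
  exact: lt_le_trans h3.
- exact: t0.
- by move=> j; rewrite /p divr_ge0 ?powR_ge0 ?ltW.
- exact: ple.
- rewrite /p -mulr_suml.
  under eq_bigr do rewrite powRM ?(ltW (rho0 _)) ?(ltW rhom0)//.
  by rewrite -mulr_suml sumT divff// gt_eqF.
- rewrite ltW//=; apply: lt_le_trans (_ : (1 : R) `^ t <= _); last by rewrite powR1.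
  by apply: (gt0_ltr_powR t0); rewrite ?nnegrE ?ltW.
- move=> j; apply: le_trans (ple j) _; rewrite powRM ?(ltW (rho0 _)) ?(ltW rhom0)//.
  rewrite -[leRHS]mul1r; apply: ler_wpM2r; first exact: ltW.
  apply: le_trans (_ : (1 : R) `^ t <= _); last by rewrite powR1.
  by apply: (ge0_ler_powR (ltW t0)) => //; rewrite nnegrE// ltW.
exists F, M; split=> //.
- move=> u; apply/andP; split.
    rewrite -(Fl (Num.min u a)); first by apply: Fm; rewrite ge_min lexx.
    by rewrite gt_min aV orbT.
  rewrite -(Fh (Num.max u b)); first by apply: Fm; rewrite le_max lexx.
  by rewrite le_max (ltW Vb) orbT.
- by rewrite (Fl _ aV) (Fh _ (ltW Vb)).
Qed.

(* One step function for each pair of rationals. *)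
Lemma strictly_increasing_hoelder : exists F : R -> R,
  (forall u v, 0 <= u <= 1 -> 0 <= v <= 1 -> `|F u - F v| <= enorm (gam u - gam v) `^ t) /\
  (forall u v, 0 <= u <= 1 -> 0 <= v <= 1 -> u < v -> F u < F v).
Proof.
pose P (n : nat) (FM : (R -> R) * R) := [/\ 0 < FM.2,
  forall u v, u <= v -> FM.1 u <= FM.1 v, forall u, 0 <= FM.1 u <= 1,
  forall u v, 0 <= u <= 1 -> 0 <= v <= 1 ->
        `|FM.1 u - FM.1 v| <= FM.2 * enorm (gam u - gam v) `^ t &
  forall x y : rat, unpickle n = Some (x, y) -> 0 <= (ratr x : R) -> (ratr x : R) < ratr y ->
    (ratr y : R) <= 1 -> FM.1 (ratr x) < FM.1 (ratr y)].
have /choice[FM FMP] : forall n, exists FM, P n FM.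
  move=> n.
  (* Indices that encode no admissible pair of rationals get the zero function, with constant 1. *)
  have triv : (forall x y : rat, unpickle n = Some (x, y) ->
      0 <= (ratr x : R) -> (ratr x : R) < ratr y ->
      (ratr y : R) <= 1 -> False) -> exists FM, P n FM.
    move=> H; exists (fun=> 0, 1); split => //=.
    - by move=> u v _ _; rewrite subrr normr0 mul1r powR_ge0.
    - by move=> x y E x0 xy y1; exfalso; exact: H E x0 xy y1.
  case E : (unpickle n : option (rat * rat)) => [[x y]|]; last by apply: triv => x y; rewrite E.
  have [[x0 [xy y1]]|H] := pselect (0 <= (ratr x : R) /\ (ratr x : R) < ratr y /\ (ratr y : R) <= 1).
    have [F [M [M0 Fm F01 Fab FH]]] := step_function x0 xy y1.
    by exists (F, M); split => //= x' y'; rewrite E => -[<- <-].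
  by apply: triv => x' y'; rewrite E => -[<- <-] *; exact: H.
(* The denominator makes both the weights and the weighted Hoelder constants summable with total at
   most 1. *)
pose w n : R := 2^-1 ^+ n.+1 / (1 + (FM n).2).
have half0 n : 0 < (2^-1 : R) ^+ n by rewrite exprn_gt0// invr_gt0.
have M1 n : 0 < 1 + (FM n).2 by have [? _ _ _ _] := FMP n; lra.
have w0 n : 0 < w n by rewrite divr_gt0.
have wM n : w n * (FM n).2 <= 2^-1 ^+ n.+1.
  rewrite /w mulrAC ler_pdivrMr// ler_wpM2l// ?(ltW (half0 _))//; lra.
have w1 n : w n <= 2^-1 ^+ n.+1.
  rewrite /w ler_pdivrMr// ler_peMr// ?(ltW (half0 _))//; have [? _ _ _ _] := FMP n; lra.
pose s n u := \sum_(k < n) w k * (FM k).1 u.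
have sc u : (s ^~ u) @ \oo --> limn (s ^~ u).
  have h2 : 0 <= (2^-1 : R) < 1 by rewrite invr_ge0 ler0n /= invf_lt1// ltr1n.
  have K0 : 0 <= (2^-1 : R) by rewrite invr_ge0.
  apply: (geometric_increments_cvg K0 h2 _).2 => n.
  rewrite /s big_ord_recr /= addrAC subrr add0r -exprS.
  have [_ _ /(_ u)/andP[F0 F1] _ _] := FMP n.
  rewrite normrM !ger0_norm// ?(ltW (w0 _))//; apply: le_trans (w1 n).
  by rewrite -[leRHS]mulr1; apply: ler_wpM2l => //; exact: ltW.
have hs n : \sum_(k < n) (2^-1 : R) ^+ k.+1 <= 1.
  suff -> : \sum_(k < n) (2^-1 : R) ^+ k.+1 = 1 - 2^-1 ^+ n by have := half0 n; lra.
  elim: n => [|n IH]; first by rewrite big_ord0 expr0 subrr.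
  rewrite big_ord_recr /= IH exprS; lra.
have dlim u v : `|s n u - s n v| @[n --> \oo] --> `|limn (s ^~ u) - limn (s ^~ v)|.
  by apply: cvg_norm; apply: cvgB; exact: sc.
exists (fun u => limn (s ^~ u)); split=> [u v u01 v01|u v u01 v01 uv].
  rewrite -(cvg_lim _ (dlim u v))//; apply: limr_le; first by apply/cvg_ex; eexists; exact: dlim.
  apply: nearW => n; rewrite /s -sumrB.
  apply: le_trans (ler_norm_sum _ _ _) _.
  apply: le_trans (_ : \sum_(k < n) (2^-1 ^+ k.+1 * enorm (gam u - gam v) `^ t) <= _).
    apply: ler_sum => k _; rewrite -mulrBr normrM (ger0_norm (ltW (w0 k))).
    have [_ _ _ H _] := FMP k.
    apply: le_trans (ler_wpM2l (ltW (w0 k)) (H u v u01 v01)) _.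
    by rewrite mulrA; apply: ler_wpM2r; [exact: powR_ge0|exact: wM].
  by rewrite -mulr_suml -[leRHS]mul1r; apply: ler_wpM2r; [exact: powR_ge0|exact: hs].
(* The term for rationals [x < y] between [u] and [v] increases strictly; all other terms are
   nondecreasing. *)
have [x /=] := rat_in_itvoo uv; rewrite in_itv /= => /andP[ux xv].
have [y /=] := rat_in_itvoo xv; rewrite in_itv /= => /andP[xy yv].
pose n0 := pickle (x, y).
have [_ Fm F01 _ Fxy] := FMP n0.
have lt : (FM n0).1 u < (FM n0).1 v.
  have [/andP[u0 _] /andP[_ v1]] := (u01, v01).
  apply: le_lt_trans (Fm _ _ (ltW ux)) _; apply: lt_le_trans (Fm _ _ (ltW yv)).
  apply: Fxy => //; first by rewrite pickleK.
  - by rewrite (le_trans u0)// ltW.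
  - by rewrite (le_trans _ v1)// ltW.
rewrite -subr_gt0; apply: lt_le_trans (_ : w n0 * ((FM n0).1 v - (FM n0).1 u) <= _).
  by rewrite mulr_gt0// subr_gt0.
have dlim' : (fun n => s n v - s n u) @ \oo --> limn (s ^~ v) - limn (s ^~ u).
  by apply: cvgB; exact: sc.
rewrite -(cvg_lim _ dlim')//; apply: limr_ge; first by apply/cvg_ex; eexists; exact: dlim'.
exists n0.+1 => // n /= nn; rewrite /s -sumrB (bigD1 (Ordinal nn))//= -mulrBr lerDl.
apply: sumr_ge0 => k _; rewrite -mulrBr mulr_ge0 ?(ltW (w0 k))// subr_ge0.
by have [_ H _ _ _] := FMP k; exact: H (ltW uv).
Qed.

End self_similar_arc_function.
End arc.
(** * Criticality *)

Lemma powR_lt1_decr (R : realType) (a t t' : R) : 0 < a < 1 -> t < t' ->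
  a `^ t' < a `^ t.
Proof.
move=> /andP[a0 a1] tt'; have d0 : 0 < t' - t by rewrite subr_gt0.
have -> : a `^ t' = a `^ t * a `^ (t' - t).
  by rewrite -powRD ?(gt_eqF a0) ?implybT// addrC subrK.
rewrite -[ltRHS]mulr1 ltr_pM2l ?powR_gt0//.
apply: lt_le_trans (_ : (1 : R) `^ (t' - t) <= _); last by rewrite powR1.
by apply: (gt0_ltr_powR d0); rewrite ?nnegrE ?ltW.
Qed.

Lemma hausdorff_dim_le (R : realType) (N : nat) (E : set 'rV[R]_N) (t : R) :
  0 <= t -> hausdorff_measure t E = 0%E -> (hausdorff_dim E <= t%:E)%E.
Proof. by move=> t0 H0; apply: ereal_inf_lbound; exists t. Qed.

(** An exponent above the dimension exceeds some [t] of zero measure, which makes the function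
    constant. *)
Lemma criticality_le_hausdorff_dim (R : realType) (N : nat) (E : set 'rV[R]_N) :
  connected E -> (criticality E <= hausdorff_dim E)%E.
Proof.
move=> cE; apply: ge_ereal_sup => _ [r [f [M [[x [y [Ex Ey fxy]]] M0 hf]]] <-].
rewrite leNgt; apply/negP => /ereal_inf_lt[_ [t [t0 H0] <-]]; rewrite lte_fin => tr.
by apply: fxy; apply: (hoelder_connected_constant cE M0 _ H0 hf) => //; rewrite t0.
Qed.

(** * From Hoelder functions to strict Whitney sets *)

Section self_similar_arc_facts.
Variables (R : realType) (N : nat) (L : set 'rV[R]_N).
Variables (gam : R -> 'rV[R]_N) (g : 'rV[R]_N -> R).
Hypotheses (cL : compact L) (cgam : {within `[0, 1]%classic, continuous gam}).
Hypotheses (Lgam : forall u, 0 <= u <= 1 -> L (gam u)).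
Hypotheses (g01 : forall x, L x -> 0 <= g x <= 1).
Hypotheses (gK : forall u, 0 <= u <= 1 -> g (gam u) = u).
Hypotheses (gamK : forall x, L x -> gam (g x) = x).

Lemma arc_connected : connected L.
Proof.
have -> : L = gam @` `[0, 1]%classic.
  apply/seteqP; split=> [x Lx|_ [u /= u01 <-]].
    by exists (g x); rewrite /= ?in_itv/=; [exact: g01|exact: gamK].
  by apply: Lgam; rewrite in_itv in u01.
apply: connected_continuous_connected cgam.
apply/connected_intervalP => x y /=; rewrite !in_itv /= => /andP[x0 _] /andP[_ y1] z /andP[xz zy].
by rewrite in_itv /= (le_trans x0 xz) (le_trans zy y1).
Qed.

Lemma arc_no_isolated_point (U : set 'rV[R]_N) x : open U -> L x -> U x ->
  exists v, [/\ 0 <= v <= 1, v <> g x & U (gam v)].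
Proof.
move=> oU Lx Ux; have u01 := g01 Lx; set u := g x in u01 *.
have /nbhs_normP[e /= e0 eU] : \forall y \near x, U y by exact: open_nbhs_nbhs.
have u01' : `[0, 1]%classic u by rewrite /= in_itv.
have [d d0 dP] := (proj1 (within_continuous_epsP _ _) cgam) u u01' e e0.
have near v : 0 <= v <= 1 -> `|u - v| < d -> U (gam v).
  move=> v01 uv; apply: eU; rewrite /ball_ /= -(gamK Lx) -/u; apply: dP => //.
(* A shift of at most one half, directed towards the farther end, stays in the unit interval. *)
pose h : R := Num.min (d / 2) (2^-1).
have h0 : 0 < h by rewrite lt_min divr_gt0//= invr_gt0.
have hd : h <= d / 2 by rewrite ge_min lexx.
have h2 : h <= 2^-1 by rewrite ge_min lexx orbT.
have /andP[u0 u1] := u01.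
have [lt|ge] := leP u 2^-1.
  exists (u + h); have v01 : 0 <= u + h <= 1 by apply/andP; split; lra.
  split=> //; first by move=> E; lra.
  by apply: near => //; rewrite opprD addrA subrr sub0r normrN gtr0_norm//; lra.
exists (u - h); have v01 : 0 <= u - h <= 1 by apply/andP; split; lra.
split=> //; first by move=> E; lra.
by apply: near => //; rewrite opprB addrC subrK gtr0_norm//; lra.
Qed.

(** The Whitney extension of [F \o g] is injective on the arc, and every nonempty relatively open
    subset has two points. *)
Lemma hoelder_strict_whitney_set (F : R -> R) (t : R) : 1 < t ->
  (forall u v, 0 <= u <= 1 -> 0 <= v <= 1 -> `|F u - F v| <= enorm (gam u - gam v) `^ t) ->
  (forall u v, 0 <= u <= 1 -> 0 <= v <= 1 -> u < v -> F u < F v) ->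
  strict_whitney_set L.
Proof.
move=> t1 FH Fm; split; first exact: arc_connected.
have Finj u v : 0 <= u <= 1 -> 0 <= v <= 1 -> u <> v -> F u <> F v.
  move=> u01 v01 uv; have [lt|gt|//] := ltgtP u v; apply/eqP.
    by rewrite lt_eqF// Fm.
  by rewrite gt_eqF// Fm.
have i0 : 0 <= (0 : R) <= 1 by rewrite lexx ler01.
have i1 : 0 <= (1 : R) <= 1 by rewrite lexx ler01.
have L0 : L !=set0 by exists (gam 0); exact: Lgam.
have t0 : 0 <= t by rewrite ltW// (lt_trans ltr01).
(* The price of passing from the Euclidean to the sup norm. *)
have M0 : 0 < N.+1%:R `^ t :> R by rewrite powR_gt0.
have [|W [CW WF W0]] := @Whitney_extension R N L (F \o g) t _ L0 cL t1 M0.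
  move=> x y Lx Ly /=; apply: le_trans (FH _ _ (g01 Lx) (g01 Ly)) _.
  rewrite !gamK// -powRM//; apply: (ge0_ler_powR t0); rewrite ?nnegrE ?enorm_ge0 ?mulr_ge0//.
  exact: enorm_le_norm.
exists W; split=> //.
  exists (gam 0), (gam 1); rewrite !WF /=; try exact: Lgam.
  split; try exact: Lgam.
  by rewrite !gK//; apply: Finj => // /eqP; rewrite eq_sym oner_eq0.
move=> U oU [x [Lx Ux]].
have [v [v01 vx Uv]] := arc_no_isolated_point oU Lx Ux.
exists x, (gam v); split=> //; first by split=> //; exact: Lgam.
rewrite !WF/= ?gK//; last exact: Lgam.
by apply: Finj => //; [exact: g01|move=> E; apply: vx].
Qed.

End self_similar_arc_facts.

Theorem theorem1p7 (R : realType) (N : nat) (L : set 'rV[R]_N) (s : R)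
    (harc : self_similar_arc L)
    (hdim : hausdorff_dim L = s%:E)
    (hs : 1 < s) :
  strict_whitney_set L /\ criticality L = s%:E.
Proof.
have [l [S [hsim [L0 cL LE] [gam [g [cgam cg gamL gL [gK' gamK]]]] hadj hfar]]] := harc.
have Lgam u : 0 <= u <= 1 -> L (gam u).
  by move=> u01; apply: gamL; exists u; rewrite //= in_itv.
have g01 x : L x -> 0 <= g x <= 1.
  move=> Lx; have /gL : (g @` L) (g x) by exists x.
  by rewrite /= in_itv.
have gK u : 0 <= u <= 1 -> g (gam u) = u by move=> u01; apply: gK'; rewrite /= in_itv.
have /choice[r rP] := hsim.
have hS i : similitude (r i) (S i) by have [/andP[]] := rP i.
have r1 i : r i < 1 by have [/andP[]] := rP i.
have [x0 Lx0] := L0; have [i0 _ _] : (\bigcup_(i : 'I_l) (S i @` L)) x0 by rewrite -LE.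
have [|e e0 eP] := @finite_positive_lower_bound R 'I_l (fun i => 1 - r i).
  by move=> i; rewrite subr_gt0.
have rmP i : r i <= 1 - e by have := eP i; lra.
have rm01 : 0 <= 1 - e < 1.
  by rewrite (le_trans _ (rmP i0)) ?ltW ?(hS i0).1//= ltrBlDr ltrDl.
have [B B0 LB] : exists2 B, 0 < B & forall x, L x -> `|x| < B.
  by have [B B0 BP] := ex_strict_bound_gt0 (compact_bounded cL); exists B => // x /BP.
pose D : R := N.+1%:R * (B + B).
have D0 : 0 < D by rewrite mulr_gt0// addr_gt0.
have LD x y : L x -> L y -> enorm (x - y) <= D.
  move=> /LB xB /LB yB; apply: le_trans (enorm_le_norm _) _; apply: ler_wpM2l => //.
  by apply: le_trans (ler_normB _ _) _; rewrite lerD// ltW.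
have amo i j : i != j -> at_most_one (S i @` L) (S j @` L).
  move=> ij p q pi pj qi qj.
  have [E|] := eqVneq `|i - j|%N 1%N.
    have [z zP] := hadj i j E.
    have : (S i @` L `&` S j @` L) p by split.
    have : (S i @` L `&` S j @` L) q by split.
    by rewrite zP => -> ->.
  move=> ne; have : (S i @` L `&` S j @` L) p by split.
  rewrite hfar//; move: ne; case E : `|i - j|%N => [|[|n]]// _.
  by move/eqP: E; rewrite distn_eq0 => /eqP /val_inj E; rewrite E eqxx in ij.
(* A sum below 1 at [t' < s] would bound the dimension by [t']. This leaves only a sum at least 1 at
   [t'], and strict monotonicity in the exponent gives the strict bound at [t < t']. *)
have sum_gt1 t : 0 <= t < s -> 1 < \sum_i r i `^ t.
  move=> /andP[t0 ts]; pose t' := (t + s) / 2.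
  have tt' : t < t' by rewrite /t'; lra.
  have t's : t' < s by rewrite /t'; lra.
  apply: le_lt_trans (_ : \sum_i r i `^ t' < _).
    rewrite leNgt; apply/negP => lt1; move: t's; rewrite ltNge => /negP; apply.
    rewrite -lee_fin -hdim; apply: hausdorff_dim_le; first by lra.
    by apply: (self_similar_hausdorff_measure0 L0 hS rmP rm01 D0 LD LE amo) => //; lra.
  have lt i : r i `^ t' < r i `^ t by apply: powR_lt1_decr => //; rewrite (hS i).1 r1.
  rewrite (bigD1 i0)//= [ltRHS](bigD1 i0)//=; apply: ltr_leD => //.
  by apply: ler_sum => i _; exact: ltW.
have hoelder t : 1 < t < s -> exists F : R -> R,
    (forall u v, 0 <= u <= 1 -> 0 <= v <= 1 -> `|F u - F v| <= enorm (gam u - gam v) `^ t) /\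
    (forall u v, 0 <= u <= 1 -> 0 <= v <= 1 -> u < v -> F u < F v).
  move=> /andP[t1 ts]; have t0 : 0 < t by exact: lt_trans t1.
  apply: (strictly_increasing_hoelder cL cgam cg Lgam g01 gK gamK hS rmP rm01 LD LE amo t0).
  by apply: sum_gt1; rewrite ltW.
have cLc : connected L := arc_connected cgam Lgam g01 gamK.
split.
  have [|F [FH Fm]] := hoelder ((1 + s) / 2); first by apply/andP; split; lra.
  by apply: (hoelder_strict_whitney_set cL cgam Lgam g01 gK gamK _ FH Fm); lra.
apply/eqP; rewrite eq_le -{1}hdim criticality_le_hausdorff_dim//=.
apply/lee_addgt0Pr => d d0.
(* Within [d] of [s], and still strictly between 1 and [s]. *)
pose t := Num.max (s - d) ((1 + s) / 2).
have ts : t < s by rewrite /t gt_max; apply/andP; split; lra.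
have t1 : 1 < t by rewrite /t lt_max; apply/orP; right; lra.
have st : s <= t + d by rewrite -lerBlDr le_max lexx.
have [|F [FH Fm]] := hoelder t; first by rewrite t1.
apply: le_trans (_ : (t%:E + d%:E <= _)%E); first by rewrite -EFinD lee_fin.
rewrite leeD2r//; apply: ereal_sup_ubound; exists t => //; exists (F \o g), 1; split=> //.
  have i00 : 0 <= (0 : R) <= 1 by rewrite lexx ler01.
  have i11 : 0 <= (1 : R) <= 1 by rewrite lexx ler01.
  exists (gam 0), (gam 1); split; try exact: Lgam.
  by rewrite /= !gK//; apply/eqP; rewrite lt_eqF// Fm.
by move=> x y Lx Ly /=; rewrite mul1r -{2}(gamK x Lx) -{2}(gamK y Ly); apply: FH; exact: g01.
Qed.
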